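(* Let $p$ be a prime, fix an algebraic closure $\overline{\mathbb{Q}}$ of $\mathbb{Q}$ and a prime $\mathfrak{p}$ of the ring of integers $\mathcal{O}_{\overline{\mathbb{Q}}}$ lying over $p$; identify $\overline{\mathbb{F}}_p=\mathcal{O}_{\overline{\mathbb{Q}}}/\mathfrak{p}$ and let $\mathbb{F}_q\subset\overline{\mathbb{F}}_p$ be the subfield with $q$ elements. Let Gauss sums $G_q(a)$ and Jacobi sums $J_q(\mathbf{a})$ and the sets $A'_{d,w}$ be as in the context. \begin{enumerate} \item Fix a real number $\epsilon>0$ and a positive integer $n$. There exists a constant $C_{\epsilon,n}$ depending only on $\epsilon$ and $n$ such that if $d>C_{\epsilon,n}$, $q=p^f\equiv 1\pmod d$, $a\in(\mathbb{Z}/d\mathbb{Z})^\times$, and the degree of $G_q(a)$ over $\mathbb{Q}(\mu_p)$ is $\le n$, then $$\left|\frac{\operatorname{ord}_\wp G_q(a)}{(p-1)f}-\frac12\right|<\epsilon,$$ where $\wp$ is the prime of $\mathbb{Q}(\mu_{pd})$ under $\mathfrak{p}$. \item Fix a positive integer $n$. There exist constants $C_n$ and $\epsilon_n>0$ depending only on $n$ such that if $d>C_n$, $q=p^f\equiv 1\pmod d$, $w\ge 1$, $\mathbf{a}\in A'_{d,w}$, and the degree of $J_q(\mathbf{a})$ over $\mathbb{Q}$ is $\le n$, then $$\frac{\operatorname{ord}_\wp J_q(\mathbf{a})}{f}>\epsilon_n,$$ where $\wp$ is the prime of $\mathbb{Q}(\mu_d)$ under $\mathfrak{p}$. \end{e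numerate}
   Context: $\mu_d$ denotes the group of $d$-th roots of unity in $\overline{\mathbb{Q}}$. Reduction modulo $\mathfrak{p}$ gives an isomorphism from the group of roots of unity of order prime to $p$ in $\mathcal{O}_{\overline{\mathbb{Q}}}$ onto $\overline{\mathbb{F}}_p^\times$; let $t:\overline{\mathbb{F}}_p^\times\to\overline{\mathbb{Q}}^\times$ be its inverse (and its restriction to $\mathbb{F}_q^\times$). Fix a nontrivial additive character $\psi_p:\mathbb{F}_p\to\overline{\mathbb{Q}}^\times$ and put $\psi_q=\psi_p\circ\operatorname{tr}_{\mathbb{F}_q/\mathbb{F}_p}$. For a character $\chi$ of $\mathbb{F}_q^\times$, $G_q(\chi)=-\sum_{x\in\mathbb{F}_q^\times}\chi(x)\psi_q(x)$. For $d\mid q-1$ and $a\in\mathbb{Z}/d\mathbb{Z}$, $G_q(a):=G_q(t^{-a(q-1)/d})\in\mathbb{Q}(\mu_{pd})$. For $w\ge1$ and nontrivial characters $\chi_0,\dots,\chi_{w+1}$ of $\mathbb{F}_q^\times$ with trivial product, $J_q(\chi_0,\dots,\chi_{w+1})=\frac{1}{q-1}\sum_{x_0,\dots,x_{w+1}\in\mathbb{F}_q^\times,\ x_0+\cdots+x_{w+1}=0}\chi_0(x_0)\cdots\chi_{w+1}(x_{w+1})$. $A_{d,w}\subset(\mathbb{Z}/d\mathbb{Z})^{w+2}$ is the set of tuples $\mathbf{a}=(a_0,\dots,a_{w+1})$ with all $a_i\ne0$ and $\sum a_i=0$; $A'_{d,w}$ is the subset with $\gcd(d,a_0,\dots,a_{w+1})=1$.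 For $\mathbf{a}\in A_{d,w}$ and $q\equiv1\pmod d$, $J_q(\mathbf{a}):=J_q(t^{-a_0(q-1)/d},\dots,t^{-a_{w+1}(q-1)/d})\in\mathbb{Q}(\mu_d)$. $\operatorname{ord}_\wp$ is the normalized valuation at $\wp$ (so $\operatorname{ord}_\wp(q)=(p-1)f$ in $\mathbb{Q}(\mu_{pd})$ and $\operatorname{ord}_\wp(q)=f$ in $\mathbb{Q}(\mu_d)$). *)

(* Defs.v *)
From HB Require Import structures.
From mathcomp Require Import all_boot all_order all_algebra all_field.
From mathcomp Require Import reals.
From Stdlib Require Import ClassicalEpsilon.
Set Implicit Arguments. Unset Strict Implicit. Unset Printing Implicit Defensive.
Import Order.TTheory GRing.Theory Num.Theory.
Local Open Scope ring_scope.

Definition is_prime_over (p : nat) (P : algC -> Prop) : Prop :=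
  (forall x, P x -> x \in Aint) /\ P 0 /\
  (forall x y, P x -> P y -> P (x + y)) /\
  (forall x y, x \in Aint -> P y -> P (x * y)) /\
  (forall x y, x \in Aint -> y \in Aint -> P (x * y) -> P x \/ P y) /\
  ~ P 1 /\ P p%:R.

(* The localization O_P = { a / b | a, b in O, b \notin P }, i.e. the
   valuation ring of Qbar attached to P. *)
Definition in_OP (P : algC -> Prop) (z : algC) : Prop :=
  exists a b, [/\ a \in Aint, b \in Aint, ~ P b & z = a / b].

(* has_val P p x r : the P-adic valuation of x, normalized by v(p) = 1,
   equals r  (i.e. x^s / p^m is a unit of O_P with r = m/s). *)
Definition has_val (P : algC -> Prop) (p : nat) (x : algC) (r : rat) : Prop :=
  exists (s : nat) (m : int), [/\ (0 < s)%N, r = m%:~R / s%:R,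
     in_OP P (x ^+ s * (p%:R ^ (- m))) & in_OP P (x ^+ s * (p%:R ^ (- m)))^-1].

Definition ordP (P : algC -> Prop) (p : nat) (x : algC) : rat :=
  epsilon (inhabits 0) (has_val P p x).

Definition ftr (F : finFieldType) (p f : nat) (x : F) : F :=
  \sum_(i < f) x ^+ (p ^ i).

Definition Fp_val (F : finFieldType) (p : nat) (y : F) : nat :=
  odflt 0%N (omap (@nat_of_ord p) [pick k : 'I_p | (k%:R == y)]).

(* psi_q = psi_p o tr, where psi_p(k) = zeta^k (zeta a primitive p-th root
   of unity; every nontrivial additive character of F_p has this form). *)
Definition psiq (F : finFieldType) (p f : nat) (zeta : algC) (x : F) : algC :=
  zeta ^+ Fp_val p (ftr p f x).

(* t : F_q -> Qbar is the Teichmueller lift w.r.t. P: multiplicative,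
   with values (q-1)-th roots of unity on F_q^x, and reduction mod P is a
   ring homomorphism F_q -> O/P (so t is the inverse of reduction on the
   roots of unity of order prime to p, for the embedding F_q in O/P).
   We extend t by t 0 = 0. *)
Definition teich (F : finFieldType) (P : algC -> Prop) (t : F -> algC) : Prop :=
  [/\ t 0 = 0, (forall x y, t (x * y) = t x * t y),
      (forall x, x != 0 -> t x ^+ (#|F|.-1) = 1) &
      (forall x y, P (t (x + y) - t x - t y))].

Definition gauss (F : finFieldType) (p f : nat) (zeta : algC) (t : F -> algC)
    (d a : nat) : algC :=
  - \sum_(x : F | x != 0)
      t x ^ (- Posz (a * (#|F|.-1 %/ d))) * psiq p f zeta x.

Definition jacobi (F : finFieldType) (t : F -> algC) (d w : nat)
    (a : 'I_w.+2 -> nat) : algC :=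
  (#|F|.-1)%:R^-1 *
  \sum_(x : {ffun 'I_w.+2 -> F} | [forall i, x i != 0] && (\sum_i x i == 0))
     \prod_i t (x i) ^ (- Posz (a i * (#|F|.-1 %/ d))).

Definition Aprime (d w : nat) (a : 'I_w.+2 -> nat) : bool :=
  [forall i, (0 < a i < d)%N] && ((\sum_i a i) %% d == 0)%N
  && (\big[gcdn/d]_i a i == 1)%N.

Definition inQzeta (zeta : algC) (y : algC) : Prop :=
  exists r : {poly rat}, y = (map_poly ratr r).[zeta].

Definition deg_le_over (K : algC -> Prop) (n : nat) (y : algC) : Prop :=
  exists q : {poly algC}, [/\ q != 0, (size q <= n.+1)%N,
     (forall i, K q`_i) & root q y].

(* Main.v *)
(** By Stickelberger, the valuation of [G_q(a)], normalized by [v(q) = 1], is the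
    average over [j < f] of the fractional parts [<p^j a / d>].  If [G_q(a)] has
    degree at most [n], its stabilizer [H] in [(Z/d)^*] has index at most [n] and
    contains [p], so this average equals the average of [<h a / d>] over [h] in
    [H].  The orbit [H a] is equidistributed as [d] grows: for
    [T(k) = \sum_(h in H) z^(k h)], Parseval and the invariance of [T] under [H]
    give [|T(k)|^2 <= d gcd(k, d)] up to bounded factors, and a Fejer-type count
    of [H a] in intervals follows from [phi(d) >> d^(5/6)].  Hence the average
    tends to [1/2].

    The valuation of [J_q(a)] is the sum of the averages attached to the [a_i],
    minus [1].  For [d] large at least two of the orders [d / gcd(a_i, d)] are
    large, since the [a_i] generate [Z/d] and sum to [0]; these two contribute
    almost [1/2] each, and any third index contributes at least a constant.

    Only the valuation part of Stickelberger's theorem is needed: Jacobi sums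
    bound the valuation of [G_q] above by the base-[p] digit sum, and
    [G(chi) G(chi^-1) = chi(-1) q] forces equality. *)

Require Import Defs.
From HB Require Import structures.
From mathcomp Require Import all_boot all_order all_algebra all_field.
From mathcomp Require Import all_fingroup all_solvable reals.
From mathcomp Require Import ring lra zify.
From Stdlib Require Import ClassicalEpsilon.
Import Order.TTheory GRing.Theory Num.Theory.
Local Open Scope ring_scope.

Set Implicit Arguments.
Unset Strict Implicit.
Unset Printing Implicit Defensive.

(** * Equidistribution of orbits of subgroups of bounded index *)

Lemma norm_root1 (n : nat) (z : algC) : (0 < n)%N -> z ^+ n = 1 -> `|z| = 1.
Proof.
move=> n0 zn; apply/eqP; rewrite -(@pexpr_eq1 _ _ n) //.
by rewrite -normrX zn normr1.
Qed.

Lemma conj_root1 (n : nat) (z : algC) : (0 < n)%N -> z ^+ n = 1 -> z^* = z^-1.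
Proof. by move=> n0 zn; rewrite invC_norm (norm_root1 n0 zn) expr1n invr1 mul1r. Qed.

Lemma sum_expr_period (w : algC) o : w ^+ o = 1 -> w != 1 ->
  \sum_(j < o) w ^+ j = 0.
Proof.
move=> wo w1; apply/eqP; have := subrX1 w o.
by rewrite wo subrr => /esym/eqP; rewrite mulf_eq0 subr_eq0 (negPf w1).
Qed.

(** Full periods cancel, so at most [o] terms survive; the bound is uniform in [L]. *)
Lemma norm_sum_expr_le (w : algC) o L : (0 < o)%N -> w ^+ o = 1 -> w != 1 ->
  `|\sum_(j < L) w ^+ j| <= o%:R.
Proof.
move=> o0 wo w1; have [m] := ubnP L; elim: m L => // m IH L /ltnSE Lm.
have [Lo|oL] := leqP L o.
  apply: le_trans (ler_norm_sum _ _ _) _.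
  rewrite (eq_bigr (fun=> 1)); last first.
    by move=> j _; rewrite normrX (norm_root1 o0 wo) expr1n.
  by rewrite sumr_const card_ord ler_nat.
rewrite -(subnKC (ltnW oL)) big_split_ord /= sum_expr_period // add0r.
rewrite (eq_bigr (fun j : 'I_(L - o) => w ^+ j)) ?IH //.
  by rewrite (leq_trans _ Lm) // ltn_subrL o0 (ltn_trans o0 oL).
by move=> j _; rewrite exprD wo mul1r.
Qed.

(** * Orthogonality and Parseval's identity for the characters of [Z/e] *)

Section Characters.
Variables (e : nat) (z : algC).
Hypothesis zP : e.-primitive_root z.

Let e_gt0 : (0 < e)%N. Proof. exact: prim_order_gt0 zP. Qed.

Lemma sum_prim_expr m m' :
  \sum_(k < e) z ^+ (k * m) * (z ^+ (k * m'))^* =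
  e%:R * (m == m' %[mod e])%:R.
Proof.
have z0 : z != 0.
  apply/eqP => z0; have := prim_expr_order zP.
  by rewrite z0 expr0n eqn0Ngt e_gt0 => /esym/eqP; rewrite oner_eq0.
pose w := z ^+ m / z ^+ m'.
have wE k : z ^+ (k * m) * (z ^+ (k * m'))^* = w ^+ k.
  rewrite (@conj_root1 e) //; last first.
    by rewrite exprAC (prim_expr_order zP) expr1n.
  by rewrite expr_div_n -!exprM ![(k * _)%N]mulnC.
under eq_bigr do rewrite wE.
have w1 : (w == 1) = (m == m' %[mod e]).
  rewrite -(eq_prim_root_expr zP) -(inj_eq (mulIf (expf_neq0 m' z0))).
  by rewrite divfK ?expf_neq0 // mul1r.
have [h|h] := boolP (w == 1).
  rewrite -w1 h mulr1 (eqP h) (eq_bigr (fun=> 1)) ?sumr_const ?card_ord //.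
  by move=> i _; rewrite expr1n.
rewrite -w1 (negPf h) mulr0 sum_expr_period //.
by rewrite expr_div_n -!exprM ![(_ * e)%N]mulnC !exprM (prim_expr_order zP) !expr1n divr1.
Qed.

Lemma parseval (I : finType) (A : {set I}) (r : I -> nat) :
  \sum_(k < e) `|\sum_(i in A) z ^+ (k * r i)| ^+ 2 =
  e%:R * \sum_(i in A) #|[set j in A | r i == r j %[mod e]]|%:R.
Proof.
transitivity (\sum_(k < e) \sum_(i in A) \sum_(j in A)
                 z ^+ (k * r i) * (z ^+ (k * r j))^*).
  apply: eq_bigr => k _; rewrite normCK rmorph_sum /= mulr_suml.
  by apply: eq_bigr => i _; rewrite mulr_sumr.
rewrite exchange_big /= mulr_sumr; apply: eq_bigr => i _.
rewrite exchange_big /= -sum1_card natr_sum mulr_sumr.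
rewrite [RHS](eq_bigl (fun j => (j \in A) && (r i == r j %[mod e]))); last first.
  by move=> j; rewrite inE.
rewrite [RHS]big_mkcondr /=; apply: eq_bigr => j _; rewrite (sum_prim_expr (r i)).
by case: ifP; rewrite ?mulr1 ?mulr0.
Qed.

End Characters.

(** * Exponential sums over an orbit and Fejer-weighted counts *)

Section OrbitSums.
Variables (gT : finGroupType) (H : {group gT}) (rho : gT -> nat).
Variables (e n : nat) (z : algC).
Hypothesis zP : e.-primitive_root z.
Hypothesis rhoM :
  {in H &, forall x y, rho (x * y)%g = (rho x * rho y)%N %[mod e]}.
(** This encodes an image of index at most [n] among the units modulo [e]: if the fibres of [rho]
    all have the same size, that size is [#|H|] over the size of the image, hence at most
    [n * #|H| / totient e]. *)
Hypothesis rho_fib : forall c,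
  (#|[set h in H | rho h == c %[mod e]]| * totient e <= n * #|H|)%N.

Let e_gt0 : (0 < e)%N. Proof. exact: prim_order_gt0 zP. Qed.

Definition orbit_sum k := \sum_(h in H) z ^+ (k * rho h).

Lemma prim_expr_congr i j : i = j %[mod e] -> z ^+ i = z ^+ j.
Proof. by move=> ij; apply/eqP; rewrite (eq_prim_root_expr zP) ij. Qed.

Lemma orbit_sum_mod k : orbit_sum (k %% e) = orbit_sum k.
Proof.
by apply: eq_bigr => h _; apply: prim_expr_congr; rewrite modnMml.
Qed.

Lemma orbit_sum_mul k h : h \in H -> orbit_sum (k * rho h) = orbit_sum k.
Proof.
move=> hH; rewrite /orbit_sum [RHS](reindex_inj (mulgI h)) /=.
apply: eq_big => [x|x xH]; first by rewrite groupMl.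
apply: prim_expr_congr; rewrite -mulnA.
by rewrite -modnMmr -rhoM // modnMmr.
Qed.

Lemma norm_orbit_sum_le k : `|orbit_sum k| <= #|H|%:R.
Proof.
apply: le_trans (ler_norm_sum _ _ _) _.
rewrite (eq_bigr (fun=> 1)) ?sumr_const // => h _.
by rewrite (@norm_root1 e) // exprAC (prim_expr_order zP) expr1n.
Qed.

(** Two solutions agree modulo [e / gcdn k e], so a solution is determined by which of the
    [gcdn k e] blocks of that length contains it. *)
Lemma card_lin_congr k c :
  (#|[set y : 'I_e | k * y == c %[mod e]]| <= gcdn k e)%N.
Proof.
set S := [set _ | _]; pose g := gcdn k e.
have g0 : (0 < g)%N by rewrite gcdn_gt0 e_gt0 orbT.
have e1e : (e %/ g * g = e)%N by rewrite divnK // dvdn_gcdr.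
have e10 : (0 < e %/ g)%N by rewrite divn_gt0 // dvdn_leq // dvdn_gcdr.
have lt_g (y : 'I_e) : (y %/ (e %/ g) < g)%N by rewrite ltn_divLR // mulnC e1e.
pose F (y : 'I_e) := Ordinal (lt_g y).
rewrite -[leqRHS]card_ord -(@card_in_imset _ _ F) ?max_card //.
move=> y y'; rewrite !inE => /eqP ky /eqP ky' [] Fyy'; apply: val_inj => /=.
suff yy' : y = y' %[mod e %/ g].
  by rewrite (divn_eq y (e %/ g)) (divn_eq y' (e %/ g)) Fyy' yy'.
wlog le : y y' ky ky' {Fyy'} / (y' <= y)%N.
  by move=> W; case: (leqP y' y) => [|/ltnW] le; [|symmetry]; apply: W.
apply/eqP; rewrite eqn_mod_dvd //.
have : (e %| k * (y - y'))%N by rewrite mulnBr -eqn_mod_dvd ?leq_mul // ky ky'.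
rewrite -{1}e1e -(divnK (dvdn_gcdl k e)) -/g mulnAC dvdn_pmul2r //.
rewrite Gauss_dvdr // coprime_sym /coprime -(eqn_pmul2r g0) muln_gcdl mul1n.
by rewrite e1e divnK ?dvdn_gcdl.
Qed.

(** The sum takes the same value at all [k * rho h]. Averaging its square over [h] and grouping by
    the residue [c] of [k * rho h] gives a sum over all [c < e] with bounded multiplicities, to
    which Parseval applies. *)
Lemma orbit_sum_bound k :
  (totient e)%:R ^+ 2 * `|orbit_sum k| ^+ 2 <=
  (n ^ 2 * e * gcdn k e * #|H| ^ 2)%:R :> algC.
Proof.
have H0 : 0 < #|H|%:R :> algC by rewrite ltr0n cardG_gt0.
rewrite -(ler_pM2r H0).
have -> : (totient e)%:R ^+ 2 * `|orbit_sum k| ^+ 2 * #|H|%:R =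
   (totient e)%:R * \sum_(c < e) `|orbit_sum c| ^+ 2 *
     (#|[set h in H | k * rho h == c %[mod e]]| * totient e)%:R.
  rewrite [(totient e)%:R ^+ 2]expr2 -!mulrA; congr (_ * _).
  rewrite -sumr_const !mulr_sumr.
  transitivity (\sum_(h in H) \sum_(c < e | k * rho h == c %[mod e])
      `|orbit_sum c| ^+ 2 * (totient e)%:R).
    apply: eq_bigr => h hH.
    rewrite (big_pred1 (Ordinal (ltn_pmod (k * rho h) e_gt0))) => [|c].
      by rewrite orbit_sum_mod orbit_sum_mul // mulr1 [LHS]mulrC.
    by rewrite (modn_small (ltn_ord c)) /= -val_eqE eq_sym.
  rewrite (exchange_big_dep xpredT) //=; apply: eq_bigr => c _.
  rewrite natrM -sum1dep_card natr_sum mulr_suml mulr_sumr.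
  by apply: eq_bigr => h _; rewrite mul1r.
(* Multiplicity of [c]: at most [gcdn k e] residues [y] solve [k * y = c], and each has a fibre
   bounded by [rho_fib]. *)
have card_k (c : 'I_e) : (#|[set h in H | k * rho h == c %[mod e]]| * totient e
    <= gcdn k e * (n * #|H|))%N.
  set Y := [set y : 'I_e | k * y == c %[mod e]].
  apply: (@leq_trans (\sum_(y in Y) n * #|H|)); last first.
    by rewrite sum_nat_const leq_mul2r card_lin_congr orbT.
  apply: (@leq_trans (\sum_(y in Y)
    #|[set h in H | rho h == y %[mod e]]| * totient e)); last first.
    exact: leq_sum.
  rewrite -big_distrl leq_mul2r /=; apply/orP; right.
  rewrite (eq_bigr (fun y : 'I_e =>
     \sum_(h in H | rho h == y %[mod e]) 1)%N); last first.
    by move=> y _; rewrite sum1dep_card.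
  rewrite (exchange_big_dep (mem H)) /=; last by move=> ? ? _ /andP[].
  rewrite -sum1dep_card big_mkcondr /=; apply: leq_sum => h hH.
  case: ifP => // kh; rewrite sum1dep_card card_gt0; apply/set0Pn.
  exists (Ordinal (ltn_pmod (rho h) e_gt0)).
  by rewrite !inE hH /= modnMmr modn_mod eqxx kh.
apply: (@le_trans _ _ ((totient e)%:R * \sum_(c < e) `|orbit_sum c| ^+ 2 *
    (gcdn k e * (n * #|H|))%:R)).
  rewrite ler_wpM2l ?ler0n //; apply: ler_sum => c _.
  by rewrite ler_wpM2l ?exprn_ge0 // ler_nat.
rewrite -mulr_suml (parseval zP) mulrA -natr_sum -!natrM ler_nat.
(* The collisions in Parseval are again fibres of [rho], which gives the second factor
   [n / totient e]. *)
have le : (totient e * \sum_(i in H) #|[set j in H | rho i == rho j %[mod e]]|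
   <= #|H| * (n * #|H|))%N.
  rewrite big_distrr -sum_nat_const /=; apply: leq_sum => h _; rewrite mulnC.
  rewrite (eq_card (B := [set j in H | rho j == rho h %[mod e]])) //.
  by move=> j; rewrite !inE eq_sym.
rewrite [X in (X * _ <= _)%N]mulnCA.
apply: (@leq_trans (e * (#|H| * (n * #|H|)) * (gcdn k e * (n * #|H|)))).
  by rewrite leq_mul2r leq_mul2l le !orbT.
apply: eq_leq; rewrite !expnS !expn0; ring.
Qed.

(** A Dirichlet kernel; its squared modulus is the Fourier transform of the weight in
    [close_count]. *)
Definition interval_sum L k := \sum_(i < L) z ^+ (k * i).

(** A smoothed count of the orbit points near [u]: each point is weighted by the number of pairs
    [(i, j)] whose difference is its displacement from [u]. This triangular weight has nonnegative
    Fourier coefficients with a bounded sum. *)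
Definition close_count a u L :=
  (\sum_(h in H) \sum_(i < L) \sum_(j < L)
     (a * rho h + j == u + i %[mod e]))%N.

Lemma close_countE a u L :
  e%:R * (close_count a u L)%:R =
  \sum_(k < e) orbit_sum (k * a) * (z ^+ (k * u))^* *
     `|interval_sum L k| ^+ 2.
Proof.
rewrite /close_count natr_sum mulr_sumr.
transitivity (\sum_(h in H) \sum_(k < e) z ^+ (k * a * rho h) *
    (z ^+ (k * u))^* * `|interval_sum L k| ^+ 2); last first.
  by rewrite exchange_big; apply: eq_bigr => k _; rewrite !mulr_suml.
apply: eq_bigr => h hH; rewrite natr_sum mulr_sumr.
transitivity (\sum_(i < L) \sum_(k < e) z ^+ (k * a * rho h) *
    (z ^+ (k * u))^* * (interval_sum L k * (z ^+ (k * i))^*)); last first.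
  rewrite exchange_big; apply: eq_bigr => k _.
  by rewrite normCK /interval_sum rmorph_sum !mulr_sumr.
apply: eq_bigr => i _; rewrite natr_sum mulr_sumr.
rewrite (eq_bigr (fun j : 'I_L => \sum_(k < e) z ^+ (k * (a * rho h + j)) *
    (z ^+ (k * (u + i)))^*)); last by move=> j _; rewrite (sum_prim_expr zP).
rewrite exchange_big; apply: eq_bigr => k _.
rewrite /interval_sum mulr_suml mulr_sumr; apply: eq_bigr => j _.
rewrite !mulnDr !exprD rmorphM /= !mulnA; ring.
Qed.

(** These are the characters of order [e / gcdn k e] at most [E]. Such a [k] is recovered from its
    order and from [k / gcdn k e], which is smaller than the order; the predecessor in [F] shifts
    the order into ['I_E]. *)
Lemma card_small_order E :
  (#|[set k : 'I_e | e <= E * gcdn k e]| <= E * E)%N.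
Proof.
set S := [set _ | _].
have [E0|E0] := posnP E.
  rewrite E0 leqn0 cards_eq0; apply/eqP/setP => k.
  by rewrite !inE E0 leqNgt e_gt0.
have gP (k : nat) : (0 < gcdn k e)%N by rewrite gcdn_gt0 e_gt0 orbT.
have ge (k : nat) : (e %/ gcdn k e * gcdn k e = e)%N by rewrite divnK ?dvdn_gcdr.
have gk (k : nat) : (k %/ gcdn k e * gcdn k e = k)%N by rewrite divnK ?dvdn_gcdl.
have eg0 (k : nat) : (0 < e %/ gcdn k e)%N.
  by rewrite divn_gt0 // dvdn_leq ?dvdn_gcdr.
pose o : 'I_E := Ordinal E0.
pose F (k : 'I_e) : 'I_E * 'I_E :=
  (insubd o (e %/ gcdn k e).-1%N, insubd o (k %/ gcdn k e)%N).
rewrite -[E in (_ <= E * _)%N]card_ord -[E in (_ <= _ * E)%N]card_ord -card_prod.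
rewrite -(@card_in_imset _ _ F) ?max_card //.
have bnd (k : 'I_e) : k \in S ->
   ((e %/ gcdn k e).-1 < E)%N /\ (k %/ gcdn k e < E)%N.
  rewrite inE => kS.
  have le : (e %/ gcdn k e <= E)%N by rewrite -(leq_pmul2r (gP k)) ge.
  split; first by rewrite prednK.
  apply: leq_trans le; rewrite -(ltn_pmul2r (gP k)) ge gk; exact: ltn_ord.
move=> k k' kS k'S [].
have [b1 b2] := bnd k kS; have [b1' b2'] := bnd k' k'S.
move=> /(congr1 val); rewrite !val_insubd b1 b1' => e1.
move=> /(congr1 val); rewrite !val_insubd b2 b2' => e2.
have {}e1 : (e %/ gcdn k e = e %/ gcdn k' e)%N.
  by rewrite -(prednK (eg0 k)) e1 prednK.
have gg : gcdn k e = gcdn k' e.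
  by apply/eqP; rewrite -(eqn_pmul2l (eg0 k)) {2}e1 !ge.
by apply: val_inj; rewrite /= -(gk k) e2 gg gk.
Qed.

(** The character [k = 0] gives the main term. Characters of order above [E] contribute through [B]
    and Parseval for the interval. At most [E * E] others remain, each bounded by [#|H|] times the
    square of its order. As [a] is a unit, [k * a] and [k] have the same order. *)
Lemma close_count_bound a u L E (B : algC) :
  coprime a e -> (L <= e)%N -> 0 <= B ->
  (forall k, (E * gcdn k e < e)%N -> `|orbit_sum k| <= B) ->
  `|e%:R * (close_count a u L)%:R - #|H|%:R * L%:R ^+ 2|
    <= B * e%:R * L%:R + #|H|%:R * E%:R ^+ 4.
Proof.
move=> ae Le B0 hB; rewrite close_countE (bigD1 (Ordinal e_gt0)) //=.
have -> : orbit_sum (0 * a) * (z ^+ (0 * u))^* * `|interval_sum L 0| ^+ 2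
   = #|H|%:R * L%:R ^+ 2.
  rewrite !mul0n expr0 rmorph1 mulr1 /orbit_sum /interval_sum.
  under eq_bigr do rewrite mul0n expr0.
  under [X in _ * `|X| ^+ 2]eq_bigr do rewrite mul0n expr0.
  by rewrite !sumr_const card_ord normr_nat.
rewrite [X in `|X|]addrC addKr; apply: le_trans (ler_norm_sum _ _ _) _.
have nzu m : `|(z ^+ m)^*| = 1.
  by rewrite norm_conjC (@norm_root1 e) // exprAC (prim_expr_order zP) expr1n.
apply: (@le_trans _ _ (\sum_(k < e | k != Ordinal e_gt0)
   (B * `|interval_sum L k| ^+ 2 +
    if (e <= E * gcdn k e)%N then #|H|%:R * E%:R ^+ 2 else 0))).
  apply: ler_sum => k k0; rewrite 2!normrM nzu mulr1 normrX normr_id.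
  have gka : gcdn (k * a) e = gcdn k e by rewrite gcdnC Gauss_gcdl 1?coprime_sym // gcdnC.
  case: leqP => [le|lt]; last first.
    by rewrite addr0 ler_wpM2r ?exprn_ge0 // hB // gka.
  rewrite -[leLHS]add0r lerD ?mulr_ge0 ?exprn_ge0 //.
  rewrite ler_pM ?exprn_ge0 ?norm_orbit_sum_le // lerXn2r ?nnegrE //.
  rewrite /interval_sum; under eq_bigr do rewrite exprM.
  have gP : (0 < gcdn k e)%N by rewrite gcdn_gt0 e_gt0 orbT.
  apply: (@le_trans _ _ (e %/ gcdn k e)%N%:R); last first.
    by rewrite ler_nat -(leq_pmul2r gP) divnK ?dvdn_gcdr.
  apply: norm_sum_expr_le.
  - by rewrite divn_gt0 // dvdn_leq ?dvdn_gcdr.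
  - rewrite -exprM muln_divCA ?dvdn_gcdl ?dvdn_gcdr //.
    by rewrite exprM (prim_expr_order zP) expr1n.
  - by rewrite -(expr0 z) (eq_prim_root_expr zP) mod0n modn_small.
rewrite big_split /= lerD //.
  rewrite -mulr_sumr -mulrA ler_wpM2l //.
  apply: (@le_trans _ _ (\sum_(k < e) `|interval_sum L k| ^+ 2)).
    by rewrite [leRHS](bigD1 (Ordinal e_gt0)) //= lerDr exprn_ge0.
  have := parseval zP [set: 'I_L] (fun i => i).
  rewrite (eq_bigr (fun k : 'I_e => `|interval_sum L k| ^+ 2)) => [->|k _]; last first.
    by congr (`|_| ^+ 2); apply: eq_bigl => i; rewrite inE.
  rewrite ler_wpM2l // (eq_bigr (fun=> 1)) ?sumr_const ?cardsT ?card_ord //.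
  move=> i _; apply/eqP; rewrite pnatr_eq1; apply/cards1P; exists i; apply/setP => j.
  rewrite !inE /= !modn_small ?(leq_trans _ Le) // -val_eqE /=.
  exact: eq_sym.
rewrite -big_mkcondr sumr_const -[leLHS]mulr_natl.
rewrite (_ : #|H|%:R * E%:R ^+ 4 = (E * E)%:R * (#|H|%:R * E%:R ^+ 2)); last first.
  by rewrite natrM; ring.
rewrite ler_wpM2r ?mulr_ge0 ?exprn_ge0 // ler_nat.
apply: leq_trans (card_small_order E); apply: subset_leq_card.
by apply/subsetP => k; rewrite !inE; case/andP.
Qed.

End OrbitSums.

Lemma leq_sum_atmost1 (I : finType) (c : pred I) (F : I -> nat) B :
  (forall i, c i -> (F i <= B)%N) -> (forall i j, c i -> c j -> i = j) ->
  (\sum_(i | c i) F i <= B)%N.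
Proof.
move=> FB c1; have [i ci|c0] := pickP c; last by rewrite big_pred0.
rewrite (big_pred1 i) ?FB // => j; apply/idP/eqP => [cj|-> //].
exact: c1.
Qed.

(** For a fixed [j], an orbit point with residue [x] is counted in at most one window [s], and there
    [s <= x %/ L] because [x] exceeds [s * L]. Summed over the [L] values of [j], this is at most
    [x]. *)
Lemma close_count_weighted (gT : finGroupType) (H : {group gT}) (rho : gT -> nat)
    e a L m :
  (0 < L)%N -> (m.+1 * L <= e)%N ->
  (\sum_(s < m) s * close_count H rho e a (s.+1 * L) L <=
   \sum_(h in H) (a * rho h) %% e)%N.
Proof.
move=> L0 mLe.
rewrite (eq_bigr (fun s : 'I_m => \sum_(h in H) s * \sum_(i < L) \sum_(j < L)
   (a * rho h + j == s.+1 * L + i %[mod e])))%N => [|s _]; last first.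
  by rewrite /close_count big_distrr.
rewrite exchange_big /=; apply: leq_sum => h _.
set x := (_ %% e)%N.
have e0 : (0 < e)%N by apply: leq_trans mLe; rewrite muln_gt0.
apply: (@leq_trans (\sum_(j < L) x %/ L)); last first.
  by rewrite sum_nat_const card_ord mulnC leq_divM.
rewrite (eq_bigr (fun s : 'I_m => \sum_(j < L) \sum_(i < L) s *
   (a * rho h + j == s.+1 * L + i %[mod e])))%N => [|s _]; last first.
  rewrite exchange_big /= big_distrr /=; apply: eq_bigr => j _.
  by rewrite big_distrr.
rewrite exchange_big /=; apply: leq_sum => j _; rewrite pair_bigA /=.
rewrite (eq_bigr (fun p : 'I_m * 'I_L =>
   if (a * rho h + j == p.1.+1 * L + p.2 %[mod e])%N then p.1 : nat else 0%N)); last first.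
  by move=> p _; case: eqP; rewrite ?muln1 ?muln0.
rewrite -big_mkcond /=.
(* The windows stay inside [[0, e)] because [m.+1 * L <= e], so the congruence is an equality
   without wrap-around. *)
have key (p : 'I_m * 'I_L) : (a * rho h + j == p.1.+1 * L + p.2 %[mod e])%N ->
    (x + j = p.1.+1 * L + p.2)%N.
  case: p => s i /=; rewrite -modnDml -/x => /eqP xs.
  have jL := ltn_ord j; have iL := ltn_ord i; have sm := ltn_ord s.
  have le1 : (s.+1 * L <= m * L)%N by rewrite leq_mul2r sm orbT.
  have js : (j <= s.+1 * L + i)%N.
    by rewrite (leq_trans (ltnW jL)) // mulSn -addnA leq_addr.
  suff : (x = s.+1 * L + i - j)%N by move=> ->; rewrite subnK.
  have lt : (s.+1 * L + i - j < e)%N.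
    rewrite (leq_ltn_trans (leq_subr _ _)) // (leq_trans _ mLe) // mulSn addnC.
    exact: leq_trans (leq_add iL le1).
  have xe : (x < e)%N by rewrite ltn_pmod.
  have /eqP : (x == s.+1 * L + i - j %[mod e])%N.
    by rewrite -(eqn_modDr j) subnK //; apply/eqP.
  by rewrite !modn_small.
apply: leq_sum_atmost1 => [p /key xp|p p' /key xp /key].
  rewrite leq_divRL // -(leq_add2r j) xp mulSnr -addnA leq_add2l.
  by rewrite (leq_trans (ltnW (ltn_ord j))) // leq_addr.
(* Euclidean division of [x + j] by [L] determines both [s] and [i]. *)
rewrite xp => pp'.
have e1 : p.1.+1 = p'.1.+1.
  have := congr1 (divn^~ L) pp'.
  by rewrite !divnMDl // !divn_small ?ltn_ord // !addn0.
have e2 : p.2 = p'.2 :> nat.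
  by have := congr1 (modn^~ L) pp'; rewrite !modnMDl !modn_small.
case: e1 => e1; case: p p' e1 e2 {xp pp'} => [s i] [s' i'] /= e1 e2.
by congr (_, _); apply: val_inj.
Qed.

(** * Lower bounds for Euler's function *)

Lemma totient_lower d : (0 < d)%N -> (d ^ 5 <= 128 * totient d ^ 6)%N.
Proof.
(* The inequality [p ^ 5 <= p.-1 ^ 6] holds for primes [p >= 5]; the primes 2 and 3 need the factors
   32 and 4, whose product is 128. With [c] the statement is multiplicative over coprime factors, so
   prime powers suffice. *)
pose c m := ((if 2 %| m then 32 else 1) * (if 3 %| m then 4 else 1))%N.
suff : (0 < d -> d ^ 5 <= c d * totient d ^ 6)%N.
  move=> W d0; apply: leq_trans (W d0) _; rewrite leq_mul2r; apply/orP; right.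
  by rewrite /c; do 2!case: ifP.
have [m] := ubnP d; elim: m d => // m IH d /ltnSE dm d0.
have [d1|d1] := leqP d 1.
  by have -> : d = 1%N by apply/eqP; rewrite eqn_leq d1.
have pp := pdiv_prime d1; set p := pdiv d in pp.
have [b pb dE] := pfactor_coprime pp d0; set k := logn p d in dE.
have k0 : (0 < k)%N by rewrite logn_gt0 mem_primes pp d0 pdiv_dvd.
have b0 : (0 < b)%N by move: d0; rewrite dE muln_gt0 => /andP[].
have pk1 : (1 < p ^ k)%N by rewrite -{1}(exp1n k) ltn_exp2r // prime_gt1.
have bm : (b < m)%N.
  by rewrite (leq_trans _ dm) // dE -{1}(muln1 b) ltn_pmul2l.
have bpk : coprime b (p ^ k) by rewrite coprime_sym coprimeXl.
have cM : c d = (c b * c (p ^ k))%N.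
  rewrite /c dE -!mulnA.
  have E r : prime r -> (r %| b * p ^ k = (r %| b) || (r %| p ^ k))%N.
    by move=> pr; rewrite Euclid_dvdM.
  have N r : prime r -> (r %| b -> r %| p ^ k = false)%N.
    move=> pr rb; apply/negP; rewrite Euclid_dvdX // k0 andbT dvdn_prime2 //.
    move/eqP=> rp; move: pb; rewrite prime_coprime // -rp rb; by [].
  rewrite !E //.
  case: (2 %| b)%N (N 2 isT) => [/(_ isT)-> | _];
    case: (3 %| b)%N (N 3 isT) => [/(_ isT)-> | _]; rewrite //=.
  - by case: (3 %| _)%N.
  - by case: (2 %| _)%N.
  - by rewrite !mul1n.
have base : (p ^ 5 <= c (p ^ k) * p.-1 ^ 6)%N.
  have dv r : prime r -> (r %| p ^ k = (r == p))%N.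
    by move=> pr; rewrite Euclid_dvdX // k0 andbT dvdn_prime2.
  rewrite /c !dv //; clear -pp.
  have := prime_gt1 pp; case: p pp => [|[|[|[|[|p]]]]] // _ _.
  have -> : (2 == p.+4.+1)%N = false by [].
  have -> : (3 == p.+4.+1)%N = false by [].
  rewrite /= !mul1n; set y := p.+4.
  (* Here [y] is the prime minus one and [y >= 4], so four times the prime is at most [5 * y], and
     [5 ^ 5 <= 4 ^ 5 * y]. *)
  rewrite -(leq_pmul2l (isT : (0 < 4 ^ 5)%N)) -expnMn.
  apply: (@leq_trans ((5 * y) ^ 5)); first by rewrite leq_exp2r // /y; lia.
  rewrite expnMn [(y ^ 6)%N]expnS mulnA leq_mul2r.
  by apply/orP; right; rewrite /y; lia.
rewrite cM dE totient_coprime // !expnMn mulnACA; apply: leq_mul; first exact: IH.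
rewrite totient_pfactor // -{1}(prednK k0) [(p ^ k.-1.+1)%N]expnS.
rewrite !expnMn mulnA leq_mul //.
by rewrite leq_pexp2l // expn_gt0 prime_gt0.
Qed.

Lemma floor_root k e : (0 < k)%N -> (0 < e)%N ->
  exists2 s, (0 < s)%N & (s ^ k <= e < (2 * s) ^ k)%N.
Proof.
move=> k0 e0.
have ex : exists s, (s ^ k <= e)%N by exists 1%N; rewrite exp1n.
have ub s : (s ^ k <= e -> s <= e)%N.
  move=> h; apply: leq_trans h; case: s => // s.
  by rewrite -{1}(expn1 s.+1) leq_pexp2l.
case: (ex_maxnP ex ub) => s sk smax.
have s0 : (0 < s)%N by apply: smax; rewrite exp1n.
exists s => //; rewrite sk ltnNge; apply/negP => /smax.
by rewrite leqNgt mul2n -addnn -{1}(addn0 s) ltn_add2l s0.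
Qed.

Lemma totient_lower_root s d : (0 < d)%N -> (d <= (2 * s) ^ 30)%N ->
  (d <= 128 * s ^ 5 * totient d)%N.
Proof.
move=> d0 ds; rewrite -(@leq_exp2r _ _ 6) //.
rewrite expnS; apply: leq_trans (leq_mul ds (totient_lower d0)) _.
rewrite (_ : 30 = 5 * 6)%N // expnM mulnA [(_ * 128)%N]mulnC.
(* Rounding 128 up to [4 ^ 6] makes every factor a sixth power, and [4 * 2 ^ 5] is again 128. *)
apply: (@leq_trans (4 ^ 6 * ((2 * s) ^ 5) ^ 6 * totient d ^ 6)).
  by rewrite !leq_mul2r; apply/orP; right; apply/orP; right.
rewrite -!expnMn leq_exp2r // leq_mul2r; apply/orP; right.
by rewrite expnMn mulnA.
Qed.

(* With [s ~ e^(1/30)], characters of order at most [s^12] are bounded trivially;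
   for the others [totient_lower_root] turns [orbit_sum_bound] into a saving of
   [s / (128 n)] over the trivial bound. *)
Lemma close_count_lower (gT : finGroupType) (H : {group gT}) (rho : gT -> nat)
    e n a u L s :
  {in H &, forall x y, rho (x * y)%g = (rho x * rho y)%N %[mod e]} ->
  (forall c,
    #|[set h in H | rho h == c %[mod e]]| * totient e <= n * #|H|)%N ->
  coprime a e -> (L <= e)%N -> (0 < s)%N -> (s ^ 30 <= e < (2 * s) ^ 30)%N ->
  (s * #|H| * L ^ 2 <= s * (e * close_count H rho e a u L) +
    128 * n * #|H| * e * L + s * #|H| * (s ^ 12) ^ 4)%N.
Proof.
move=> rhoM rho_fib ae Le s0 /andP[se es].
have e0 : (0 < e)%N by apply: leq_trans se; rewrite expn_gt0 s0.
have [z zP] := C_prim_root_exists e0.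
have s0C : 0 < s%:R :> algC by rewrite ltr0n.
pose B : algC := (128 * n * #|H|)%:R / s%:R.
have B0 : 0 <= B by rewrite divr_ge0.
have TB k : (s ^ 12 * gcdn k e < e)%N -> `|orbit_sum H rho z k| <= B.
  move=> /ltnW gk; rewrite ler_pdivlMr // -(ler_pXn2r (n := 2)) ?nnegrE ?mulr_ge0 //.
  have p0 : 0 < (totient e)%:R ^+ 2 :> algC.
    by rewrite exprn_gt0 // ltr0n totient_gt0.
  rewrite -(ler_pM2l p0) exprMn mulrA.
  apply: (le_trans (ler_wpM2r _ (orbit_sum_bound zP rhoM rho_fib k))).
    by rewrite exprn_ge0.
  rewrite -!natrX -!natrM ler_nat.
  (* The exponent 12 is 2 + 10: the order of [k] supplies [s ^ 12], the bound
     [e <= 128 * s ^ 5 * totient e] costs [s ^ 10] after squaring, and [s ^ 2] is left as the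
     saving. *)
  have key : (s ^ 2 * (e * gcdn k e) <= 128 ^ 2 * totient e ^ 2)%N.
    rewrite -(@leq_pmul2l (s ^ 10)) ?expn_gt0 ?s0 // mulnA -expnD.
    apply: (@leq_trans (e ^ 2)).
      by rewrite mulnCA expnS expn1 leq_mul2l gk orbT.
    rewrite [leqRHS]mulnA [(s ^ 10 * _)%N]mulnC (_ : 10 = 5 * 2)%N // expnM -!expnMn.
    by rewrite leq_exp2r // totient_lower_root // ltnW.
  rewrite (_ : (_ * s ^ 2)%N = n ^ 2 * #|H| ^ 2 * (s ^ 2 * (e * gcdn k e)))%N; last by ring.
  rewrite (_ : (_ * (128 * _ * _) ^ 2)%N =
    n ^ 2 * #|H| ^ 2 * (128 ^ 2 * totient e ^ 2))%N; last first.
    by rewrite !expnMn; move: (128 ^ 2)%N => ?; ring.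
  by rewrite leq_mul2l key orbT.
have := close_count_bound zP u ae Le B0 TB.
rewrite real_ler_norml; last by rewrite realB // rpredM ?rpredX ?realn.
case/andP=> + _.
rewrite lerNl opprB lerBlDr => le.
rewrite -(ler_nat algC) !natrD.
have -> : (s * #|H| * L ^ 2)%:R = s%:R * (#|H|%:R * L%:R ^+ 2) :> algC.
  by rewrite !natrM expr2 !mulrA.
apply: le_trans (ler_wpM2l (ltW s0C) le) _.
rewrite /B !natrM ?natrX le_eqVlt; apply/orP; left; apply/eqP.
by field; rewrite gt_eqF.
Qed.

(** * From interval counts to the mean of an orbit *)

Lemma sum_ord_rat m : \sum_(i < m) (i%:R : rat) = m%:R * (m%:R - 1) / 2.
Proof.
elim: m => [|m IH]; first by rewrite big_ord0 !mul0r.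
by rewrite big_ord_recr /= IH mulrSr; field.
Qed.

(** Dividing by [s * h * e ^ 2] turns the count into a density, with [L / e] close to [1 / K]. In
    the error [c + 3], a loss of [2 / s] comes from replacing [L / e] by [1 / K], and [1 / s] from
    the characters of small order, since [s ^ 49 <= s ^ 60 <= e ^ 2]. *)
Lemma close_density (c e s L K cc h : nat) :
  (0 < s)%N -> (0 < K)%N -> (0 < h)%N -> (s ^ 30 <= e)%N -> L = (e %/ K)%N ->
  (s * h * L ^ 2 <= s * (e * cc) + c * h * e * L + s * h * (s ^ 12) ^ 4)%N ->
  K%:R ^- 2 - (c + 3)%:R / s%:R <= cc%:R / (e%:R * h%:R) :> rat.
Proof.
move=> s0 K0 h0 se LE le.
have e0 : (0 < e)%N by apply: leq_trans se; rewrite expn_gt0 s0.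
have [sq eq0 Kq hq] : [/\ 0 < s%:R :> rat, 0 < e%:R :> rat, 0 < K%:R :> rat
   & 0 < h%:R :> rat] by rewrite !ltr0n.
have s_e : s%:R <= e%:R :> rat.
  by rewrite ler_nat (leq_trans _ se) // -{1}(expn1 s) leq_pexp2l.
have s49 : s%:R * (s%:R ^+ 12) ^+ 4 <= e%:R ^+ 2 :> rat.
  rewrite -exprM -exprS -!natrX ler_nat.
  apply: (@leq_trans ((s ^ 30) ^ 2)); last by rewrite leq_exp2r.
  by rewrite -expnM leq_pexp2l.
pose l : rat := L%:R / e%:R.
have l0 : 0 <= l by rewrite divr_ge0.
have LK : L%:R * K%:R <= e%:R :> rat by rewrite -natrM ler_nat LE leq_divM.
have KL : e%:R <= (L%:R + 1) * K%:R :> rat.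
  by rewrite natr1 -natrM ler_nat LE ltnW // ltn_ceil.
have l1 : l * K%:R <= 1 by rewrite /l mulrAC ler_pdivrMr // mul1r.
have l2 : K%:R^-1 - s%:R^-1 <= l.
  rewrite lerBlDr -(ler_pM2r Kq) mulVf ?gt_eqF // mulrDl.
  apply: (@le_trans _ _ (l * K%:R + e%:R^-1 * K%:R)).
    have -> : l * K%:R + e%:R^-1 * K%:R = (L%:R + 1) * K%:R / e%:R.
      by rewrite /l; field; rewrite gt_eqF.
    by rewrite ler_pdivlMr // mul1r.
  by rewrite lerD2l ler_pM2r // lef_pV2 // posrE.
have K1 : K%:R^-1 <= 1 :> rat by rewrite invf_le1 // ler1n.
have l3 : l <= 1 by apply: le_trans l1; rewrite ler_peMr // ler1n.
have lsq : K%:R ^- 2 - 2 / s%:R <= l ^+ 2.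
  have s1 : 0 < s%:R^-1 :> rat by rewrite invr_gt0.
  rewrite -exprVn; have : 0 < K%:R^-1 :> rat by rewrite invr_gt0.
  move: (K%:R^-1) (s%:R^-1) s1 K1 l2 => k t *; have [kt|tk] := lerP k t; nra.
have c1 : s%:R * h%:R * L%:R ^+ 2 <= s%:R * (e%:R * cc%:R) +
   c%:R * h%:R * e%:R * L%:R + s%:R * h%:R * (s%:R ^+ 12) ^+ 4 :> rat.
  move: le; rewrite -(ler_nat rat) !natrD.
  rewrite [(s * h * L ^ 2)%:R]natrM [(s * h)%:R]natrM [(L ^ 2)%:R]natrX.
  rewrite [(s * h * _)%:R]natrM [(s * h)%:R]natrM [((s ^ 12) ^ 4)%:R]natrX.
  by rewrite [(s ^ 12)%:R]natrX [(s * (e * cc))%:R]natrM !natrM.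
have c2 : l ^+ 2 - c%:R / s%:R * l - s%:R^-1 <= cc%:R / (e%:R * h%:R).
  have p : 0 < s%:R * h%:R * e%:R ^+ 2 :> rat by rewrite !mulr_gt0 ?exprn_gt0.
  rewrite -(ler_pM2l p) /l.
  have -> : s%:R * h%:R * e%:R ^+ 2 * (cc%:R / (e%:R * h%:R))
    = s%:R * (e%:R * cc%:R) :> rat by field; rewrite !gt_eqF.
  have -> : s%:R * h%:R * e%:R ^+ 2 * ((L%:R / e%:R) ^+ 2 -
      c%:R / s%:R * (L%:R / e%:R) - s%:R^-1) =
    s%:R * h%:R * L%:R ^+ 2 - c%:R * h%:R * e%:R * L%:R
       - h%:R * e%:R ^+ 2 :> rat by field; rewrite !gt_eqF.
  have : h%:R * (s%:R * (s%:R ^+ 12) ^+ 4) <= h%:R * e%:R ^+ 2 :> rat.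
    by rewrite ler_pM2l.
  lra.
apply: le_trans c2; rewrite natrD mulrDl.
have : c%:R / s%:R * l <= c%:R / s%:R :> rat.
  by rewrite ler_piMr // divr_ge0.
lra.
Qed.

Lemma equidistribution_lower (n N : nat) : (0 < N)%N ->
  exists C : nat, forall (gT : finGroupType) (H : {group gT}) (rho : gT -> nat)
    (e a : nat), (C < e)%N ->
  {in H &, forall x y, rho (x * y)%g = (rho x * rho y)%N %[mod e]} ->
  (forall c,
    #|[set h in H | rho h == c %[mod e]]| * totient e <= n * #|H|)%N ->
  coprime a e ->
  2^-1 - N%:R^-1 <=
    (\sum_(h in H) (a * rho h) %% e)%:R / (e%:R * #|H|%:R) :> rat.
Proof.
(* With [K] windows the weighted mean is [(1 - 1/K) * (1 - 2/K) / 2], up to a relative error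
   [1 / N]. The choice [K = 3 * N] makes each of the two losses at most [1 / (2 * N)]. *)
move=> N0; have [K KE] : exists K, K = (3 * N)%N by exists (3 * N)%N.
(* Once [S <= s], the error [(128 * n + 3) / s] is at most [1 / (K ^ 2 * N)]; the threshold
   [(2 * S) ^ 30] forces this. *)
pose S := (K ^ 2 * (128 * n + 3) * N)%N.
have K0 : (0 < K)%N by rewrite KE muln_gt0.
have S0 : (0 < S)%N by rewrite !muln_gt0 ?expn_gt0 K0 N0 addn_gt0 orbT.
exists ((2 * S) ^ 30)%N => gT H rho e a Ce rhoM rho_fib ae.
have e0 : (0 < e)%N by apply: leq_trans Ce.
have [s s0 /andP[se es]] := floor_root (isT : (0 < 30)%N) e0.
have Ss : (S <= s)%N.
  have := ltn_trans Ce es; rewrite ltn_exp2r // ltn_mul2l /=; exact: ltnW.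
have KS : (K <= S)%N.
  by rewrite /S -mulnA expnS expn1 -!mulnA leq_pmulr // !muln_gt0 K0 addn_gt0 orbT.
have Ke : (K <= e)%N.
  apply: leq_trans se; apply: leq_trans KS (leq_trans Ss _).
  by rewrite -{1}(expn1 s) leq_pexp2l.
pose L := (e %/ K)%N.
have L0 : (0 < L)%N by rewrite divn_gt0.
have [m Km] : exists m, K = m.+1 by exists K.-1; rewrite prednK.
have mL : (m.+1 * L <= e)%N by rewrite -Km mulnC leq_divM.
have Le : (L <= e)%N by rewrite leq_div.
have := close_count_weighted H rho a L0 mL.
rewrite -(ler_nat rat) => le1.
have [eq0 hq Nq Kq] : [/\ 0 < e%:R :> rat, 0 < #|H|%:R :> rat, 0 < N%:R :> rat
   & 0 < K%:R :> rat] by rewrite !ltr0n cardG_gt0.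
rewrite ler_pdivlMr ?mulr_gt0 //; apply: le_trans le1.
pose g : rat := K%:R ^- 2 - (128 * n + 3)%:R / s%:R.
have cc u : g * (e%:R * #|H|%:R) <= (close_count H rho e a u L)%:R.
  rewrite -ler_pdivlMr ?mulr_gt0 //.
  apply: (close_density s0 K0 (cardG_gt0 H) se (erefl L)).
  by apply: close_count_lower => //; rewrite se.
apply: (@le_trans _ _ ((\sum_(i < m) i%:R) * (g * (e%:R * #|H|%:R)))); last first.
  rewrite natr_sum mulr_suml; apply: ler_sum => i _.
  by rewrite natrM ler_wpM2l.
rewrite mulrA ler_pM2r ?mulr_gt0 // sum_ord_rat.
have gS : (128 * n + 3)%:R / s%:R <= (K%:R ^+ 2 * N%:R)^-1 :> rat.
  rewrite ler_pdivrMr ?ltr0n // mulrC ler_pdivlMr ?mulr_gt0 ?exprn_gt0 //.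
  by rewrite -natrX -!natrM ler_nat; apply: leq_trans Ss; rewrite /S mulnCA mulnA.
have mK : m%:R = K%:R - 1 :> rat by rewrite Km mulrSr addrK.
have KN : K%:R = 3 * N%:R :> rat by rewrite KE natrM.
have N1 : 1 <= N%:R :> rat by rewrite ler1n.
apply: (@le_trans _ _ (m%:R * (m%:R - 1) / 2 * (K%:R ^- 2 - (K%:R ^+ 2 * N%:R)^-1))).
  rewrite mK KN.
  have -> : (3 * N%:R - 1) * (3 * N%:R - 1 - 1) / 2 *
    ((3 * N%:R) ^- 2 - ((3 * N%:R) ^+ 2 * N%:R)^-1) =
    2^-1 - N%:R^-1 + (11 / 18 * N%:R^-1 ^+ 2 - 1 / 9 * N%:R^-1 ^+ 3) :> rat.
    by field; rewrite gt_eqF.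
  have : 0 < N%:R^-1 :> rat by rewrite invr_gt0.
  have : N%:R^-1 <= 1 :> rat by rewrite invf_le1.
  move: (N%:R^-1) => t; nra.
apply: ler_wpM2l; last by rewrite lerD2l lerN2.
by rewrite mK KN; nra.
Qed.

(** The upper bound is the lower bound for [- a], represented by [a * e.-1]: orbit points are
    nonzero modulo [e], so the residues of [x] and [- x] add up to [e]. *)
Lemma equidistribution (n N : nat) : (0 < N)%N ->
  exists C : nat, forall (gT : finGroupType) (H : {group gT}) (rho : gT -> nat)
    (e a : nat), (C < e)%N ->
  {in H &, forall x y, rho (x * y)%g = (rho x * rho y)%N %[mod e]} ->
  (forall c,
    #|[set h in H | rho h == c %[mod e]]| * totient e <= n * #|H|)%N ->
  {in H, forall x, coprime (rho x) e} -> coprime a e ->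
  `| (\sum_(h in H) (a * rho h) %% e)%:R / (e%:R * #|H|%:R) - 2^-1 |
     <= N%:R^-1 :> rat.
Proof.
move=> N0; have [C HC] := equidistribution_lower n N0.
exists C.+1 => gT H rho e a Ce rhoM rho_fib rhoe ae.
have e1 : (1 < e)%N by apply: leq_trans Ce.
have e0 : (0 < e)%N by apply: ltnW.
have [eq0 hq] : 0 < e%:R :> rat /\ 0 < #|H|%:R :> rat.
  by rewrite !ltr0n cardG_gt0.
have aeN : coprime (a * e.-1) e by rewrite coprimeMl ae coprimePn.
have lo := HC _ H rho e a (ltnW Ce) rhoM rho_fib ae.
have := HC _ H rho e _ (ltnW Ce) rhoM rho_fib aeN.
have -> : (\sum_(h in H) (a * e.-1 * rho h) %% e)%:R =
   e%:R * #|H|%:R - (\sum_(h in H) (a * rho h) %% e)%:R :> rat.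
  apply/eqP; rewrite eq_sym subr_eq -natrD -natrM eqr_nat -big_split /=.
  rewrite mulnC -sum_nat_const; apply/eqP/eq_bigr => h hH.
  set x := (a * rho h)%N.
  have -> : (a * e.-1 * rho h = x * e.-1)%N by rewrite mulnAC.
  have xe : (0 < x %% e)%N.
    rewrite lt0n -/(dvdn e x); apply/negP => ex.
    have : coprime x e by rewrite coprimeMl ae rhoe.
    by rewrite /coprime (gcdn_idPr ex) => /eqP ee; rewrite ee in e1.
  have le : (x %% e <= e)%N by rewrite ltnW // ltn_pmod.
  rewrite -[LHS](subnK le); congr (_ + _)%N.
  have lt : (e - x %% e < e)%N by rewrite ltn_subrL xe.
  rewrite -(modn_small lt); apply/eqP; rewrite -(eqn_modDr (x %% e)) subnK //.
  by rewrite modnn modnDmr -mulnSr prednK // modnMl.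
rewrite mulrBl divff ?mulf_neq0 ?gt_eqF // => up.
by rewrite ler_norml; apply/andP; split; lra.
Qed.

(** * Units modulo [d] and their reductions modulo a divisor *)

Section CoprimeLift.
Local Open Scope nat_scope.

(** To a representative [b] one adds [e] times the part of [d] prime to [b]. A prime factor of [d]
    then divides exactly one of the two summands: if it divides [b], it divides neither [e] nor that
    part. *)
Lemma coprime_lift c e d : (0 < d)%N -> e %| d -> coprime c e ->
  exists2 u, coprime u d & u = c %[mod e].
Proof.
move=> d0 ed ce; have e0 : (0 < e)%N by apply: dvdn_gt0 ed.
(* Adding [e] keeps [b] positive also when [c] is 0, so that [\pi(b)] is its set of prime
   divisors. *)
pose b := (c + e)%N; have b0 : (0 < b)%N by rewrite addn_gt0 e0 orbT.
have be : coprime b e by rewrite /coprime /b gcdnC gcdnDr gcdnC.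
exists (b + e * d`_(\pi(b)^'))%N; last by rewrite /b -addnA -mulnS addnC mulnC modnMDl.
set v := b + _.
have v0 : 0 < v by rewrite /v addn_gt0 b0.
rewrite coprime_has_primes //; apply/hasPn => r rd.
have [pr _ rdd] : [/\ prime r, (0 < d)%N & r %| d].
  by move: rd; rewrite mem_primes => /and3P.
rewrite /= mem_primes pr v0 /=; rewrite /v {v v0}; apply/negP.
have [rb|rb] := boolP (r %| b).
  rewrite dvdn_addr // Euclid_dvdM // => /orP[re|rm].
    have : r %| 1 by rewrite -(eqP be) dvdn_gcd rb re.
    by rewrite dvdn1 => /eqP r1; rewrite r1 in pr.
  have : r \in \pi(d`_(\pi(b)^')) by rewrite mem_primes pr part_gt0 rm.
  by rewrite pi_of_part // inE => /andP[_]; rewrite inE /= mem_primes pr b0 rb.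
have rm : r %| d`_(\pi(b)^').
  have : r \in \pi(d`_(\pi(b)^')).
    rewrite pi_of_part // inE rd /= inE /= mem_primes (negPf rb) !andbF.
    by [].
  by rewrite mem_primes => /and3P[].
by rewrite dvdn_addl ?(negPf rb) // dvdn_mull.
Qed.

End CoprimeLift.

Definition unat d (u : {unit 'Z_d}) : nat := FinRing.uval u.

Lemma unatM d (u v : {unit 'Z_d}) : (1 < d)%N ->
  unat (u * v)%g = (unat u * unat v %% d)%N.
Proof. by move=> d1; rewrite /unat FinRing.val_unitM -[X in _ = (_ %% X)%N]Zp_cast. Qed.

Lemma unat1 d : (1 < d)%N -> unat (1%g : {unit 'Z_d}) = 1%N.
Proof. by move=> d1; rewrite /unat FinRing.val_unit1 /= modn_small. Qed.

Lemma coprime_unat d (u : {unit 'Z_d}) : (1 < d)%N -> coprime (unat u) d.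
Proof.
move=> d1; rewrite coprime_sym -unitZpE // /unat natr_Zp; exact: (valP u).
Qed.

Lemma unat_onto d c : (1 < d)%N -> coprime c d ->
  exists u : {unit 'Z_d}, unat u = (c %% d)%N.
Proof.
move=> d1 cd; have cU : (c%:R : 'Z_d) \is a GRing.unit by rewrite unitZpE // coprime_sym.
by exists (FinRing.unit _ cU); rewrite /unat /= val_Zp_nat.
Qed.

Lemma card_unat d : (1 < d)%N -> #|[set: {unit 'Z_d}]|%N = totient d.
Proof. by move=> d1; rewrite card_units_Zp // ltnW. Qed.

(** Translation carries a nonempty fibre over [c] into the fibre over every unit [b] modulo [e]. So
    [totient e] disjoint fibres of at least that size fit into the [totient d] units. *)
Lemma unat_fiber d e n (H : {group {unit 'Z_d}}) c : (1 < d)%N -> (e %| d)%N ->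
  (totient d <= n * #|H|)%N ->
  (#|[set h in H | unat h == c %[mod e]]| * totient e <= n * #|H|)%N.
Proof.
move=> d1 ed dH; have d0 := ltnW d1; have e0 : (0 < e)%N := dvdn_gt0 d0 ed.
pose S b := [set u : {unit 'Z_d} | (unat u == b %[mod e])%N].
apply: leq_trans dH; apply: (@leq_trans (#|S c| * totient e)).
  rewrite leq_mul2r; apply/orP; right; apply: subset_leq_card.
  by apply/subsetP => u; rewrite !inE => /andP[].
have [->|[u0 u0c]] := set_0Vmem (S c); first by rewrite cards0.
have Sle b : coprime b e -> (#|S c| <= #|S b|)%N.
  move=> be; have [v' v'd v'b] := coprime_lift d0 ed be.
  have [v vE] := unat_onto d1 v'd.
  have vb : (unat v = b %[mod e])%N by rewrite vE modn_dvdm.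
  rewrite -(card_imset _ (mulIg (u0^-1 * v)%g)).
  apply: subset_leq_card; apply/subsetP => _ /imsetP[u uc ->].
  have mM (x y : {unit 'Z_d}) : (unat (x * y)%g = unat x * unat y %[mod e])%N.
    by rewrite unatM // modn_dvdm.
  move: u0c uc; rewrite !inE => /eqP u0c /eqP uc; apply/eqP.
  rewrite -vb -[in RHS](mulKVg u0 v) mM [RHS]mM -[LHS]modnMml uc -u0c.
  by rewrite modnMml.
rewrite (totient_count_coprime e) -(card_unat d1) cardsT -[leqRHS]sum1_card.
rewrite big_distrr /=.
rewrite (partition_big (fun u : {unit 'Z_d} => Ordinal (ltn_pmod (unat u) e0)) xpredT) //=.
rewrite big_mkord; apply: leq_sum => b _; case: (boolP (coprime e b)) => be; rewrite ?muln0 // muln1.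
apply: leq_trans (Sle b _) _; first by rewrite coprime_sym.
rewrite -sum1_card; apply: eq_leq; apply: eq_bigl => u.
by rewrite !inE -val_eqE /= (modn_small (ltn_ord b)).
Qed.

(** The fraction [a / d] in lowest terms is [b / e] with [e = d / gcdn a d]. Equidistribution takes
    place modulo this order [e], which is what has to be large. *)
Lemma unit_equidistribution (n N : nat) : (0 < N)%N ->
  exists C : nat, forall d (H : {group {unit 'Z_d}}) a, (1 < d)%N ->
  (totient d <= n * #|H|)%N -> (C * gcdn a d < d)%N ->
  `| \sum_(h in H) ((unat h * a) %% d)%:R / d%:R - 2^-1 * #|H|%:R |
     <= N%:R^-1 * #|H|%:R :> rat.
Proof.
move=> N0; have [C HC] := equidistribution n N0.
exists C => d H a d1 dH Cd; have d0 := ltnW d1.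
set g := gcdn a d in Cd.
have g0 : (0 < g)%N by rewrite gcdn_gt0 d0 orbT.
have [e dE] : exists e, d = (e * g)%N by exists (d %/ g)%N; rewrite divnK ?dvdn_gcdr.
have [b aE] : exists b, a = (b * g)%N by exists (a %/ g)%N; rewrite divnK ?dvdn_gcdl.
have ed : (e %| d)%N by rewrite dE dvdn_mulr.
have be : coprime b e by rewrite /coprime -(eqn_pmul2r g0) muln_gcdl -aE -dE mul1n.
have Ce : (C < e)%N by rewrite -(ltn_pmul2r g0) -dE.
have uM : {in H &, forall x y, unat (x * y)%g = (unat x * unat y)%N %[mod e]}.
  by move=> x y _ _; rewrite unatM // modn_dvdm.
have ue : {in H, forall x, coprime (unat x) e}.
  by move=> x _; apply: coprime_dvdr ed (coprime_unat x d1).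
have := HC _ H (@unat d) e b Ce uM (fun c => unat_fiber c d1 ed dH) ue be.
have e0 : (0 < e)%N by apply: leq_ltn_trans Ce.
have hq : 0 < #|H|%:R :> rat by rewrite ltr0n cardG_gt0.
rewrite -(ler_pM2r hq) -{2}(gtr0_norm hq) -normrM mulrBl.
rewrite invfM mulrA divfK ?gt_eqF // natr_sum mulr_suml.
rewrite (eq_bigr (fun h => ((unat h * a) %% d)%:R / d%:R)) // => h _.
move: (unat h) => y; rewrite dE aE mulnA -muln_modl !natrM -mulf_div divff.
  by rewrite mulr1 mulnC.
by rewrite pnatr_eq0 -lt0n.
Qed.

(** * The localization at the prime [P] *)

Section Localization.
Variables (p : nat) (P : algC -> Prop).
Hypotheses (pp : prime p) (PP : is_prime_over p P).

Lemma primeP_Aint x : P x -> x \in Aint.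
Proof. by case: PP => h _; apply: h. Qed.

Lemma primeP0 : P 0. Proof. by case: PP => _ []. Qed.

Lemma primePD x y : P x -> P y -> P (x + y).
Proof. by case: PP => _ [_ [h _]]; apply: h. Qed.

Lemma primePM x y : x \in Aint -> P y -> P (x * y).
Proof. by case: PP => _ [_ [_ [h _]]]; apply: h. Qed.

Lemma primeP_mul x y : x \in Aint -> y \in Aint -> P (x * y) -> P x \/ P y.
Proof. by case: PP => _ [_ [_ [_ [h _]]]]; apply: h. Qed.

Lemma primeP1 : ~ P 1. Proof. by case: PP => _ [_ [_ [_ [_ []]]]]. Qed.

Lemma primePp : P p%:R. Proof. by case: PP => _ [_ [_ [_ [_ []]]]]. Qed.

Lemma primePN x : P x -> P (- x).
Proof. by move=> Px; rewrite -mulN1r; apply: primePM; rewrite ?rpredN ?rpred1. Qed.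

Lemma primePB x y : P x -> P y -> P (x - y).
Proof. by move=> Px Py; apply: primePD => //; apply: primePN. Qed.

Lemma primeP_sum (I : finType) (c : pred I) (F : I -> algC) :
  (forall i, c i -> P (F i)) -> P (\sum_(i | c i) F i).
Proof. by move=> h; elim/big_ind: _ => //; [apply: primeP0 | apply: primePD]. Qed.

Lemma primeP_nat k : P k%:R -> (p %| k)%N.
Proof.
move=> Pk; apply: contraT => pk; case: primeP1.
have /eqP cpk : coprime p k by rewrite prime_coprime.
have [a _ /dvdnP[c E]] := Bezoutl k (prime_gt0 pp).
rewrite cpk in E; have -> : 1 = c%:R * p%:R - a%:R * k%:R :> algC.
  by rewrite -!natrM -E natrD addrK.
by apply: primePB; apply: primePM; rewrite ?rpred_nat //; apply: primePp.
Qed.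

Lemma primeP_root1 x n : (0 < n)%N -> x ^+ n = 1 -> ~ P x.
Proof.
move=> n0 xn Px; apply: primeP1; rewrite -xn -(prednK n0) exprSr.
by apply: primePM => //; rewrite rpredX // primeP_Aint.
Qed.

Definition OPunit z := in_OP P z /\ in_OP P z^-1.

Lemma Aint_in_OP x : x \in Aint -> in_OP P x.
Proof. by move=> xA; exists x, 1; split; rewrite ?divr1 ?rpred1 //; apply: primeP1. Qed.

Lemma in_OP_M x y : in_OP P x -> in_OP P y -> in_OP P (x * y).
Proof.
move=> [a [b [aA bA Pb ->]]] [c [d [cA dA Pd ->]]].
exists (a * c), (b * d); split; rewrite ?rpredM ?mulf_div //.
by move=> /primeP_mul -[].
Qed.

Lemma in_OP_X x n : in_OP P x -> in_OP P (x ^+ n).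
Proof.
move=> h; elim: n => [|n IH]; first by rewrite expr0; apply: Aint_in_OP; rewrite rpred1.
by rewrite exprS; apply: in_OP_M.
Qed.

Lemma OPunitM x y : OPunit x -> OPunit y -> OPunit (x * y).
Proof. by case=> a b [c d]; split; rewrite ?invfM; apply: in_OP_M. Qed.

Lemma OPunitV x : OPunit x -> OPunit x^-1.
Proof. by case=> a b; split; rewrite ?invrK. Qed.

Lemma OPunitX x n : OPunit x -> OPunit (x ^+ n).
Proof. by case=> a b; split; rewrite -?exprVn; apply: in_OP_X. Qed.

Lemma Aint_OPunit x : x \in Aint -> ~ P x -> OPunit x.
Proof.
move=> xA Px; split; first exact: Aint_in_OP.
by exists 1, x; rewrite rpred1 mul1r.
Qed.

Lemma root1_OPunit x n : (0 < n)%N -> x ^+ n = 1 -> OPunit x.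
Proof.
move=> n0 xn; apply: Aint_OPunit; last exact: primeP_root1 xn.
by apply: (@Aint_unity_root n) => //; apply/unity_rootP.
Qed.

Lemma OPunit1 : OPunit 1.
Proof. by apply: (@root1_OPunit _ 1). Qed.

Lemma OPunitN x : OPunit x -> OPunit (- x).
Proof.
by rewrite -mulN1r; apply: OPunitM; apply: (@root1_OPunit _ 2); rewrite // sqrrN expr1n.
Qed.

(** Writing [p%:R ^- k.+1] as [a / b] makes [b] a multiple of [p], hence an element of [P]. *)
Lemma OPunit_expN k : ~ OPunit (p%:R ^- k.+1).
Proof.
move=> [[a [b [aA bA Pb E]]] _]; apply: Pb.
have p0 : p%:R != 0 :> algC by rewrite pnatr_eq0 -lt0n prime_gt0.
have [->|b0] := eqVneq b 0; first exact: primeP0.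
have -> : b = a * p%:R ^+ k * p%:R.
  have -> : a = p%:R ^- k.+1 * b by rewrite E divfK.
  rewrite -mulrA -exprSr mulrAC mulVf ?mul1r //; exact: expf_neq0.
by apply: primePM; [rewrite rpredM ?rpredX ?rpred_nat | apply: primePp].
Qed.

Lemma OPunit_exp_int (m : int) : OPunit (p%:R ^ m) -> m = 0.
Proof.
case: m => [[|k]|k] //= h; last by case: (OPunit_expN h).
by case: (@OPunit_expN k); apply: OPunitV.
Qed.

(** As [ordP] is a choice, it must be shown that two witnesses give the same ratio. Comparing them
    makes [p ^ (m * s' - m' * s)] a unit of the localization, so this exponent is 0. *)
Lemma ordP_unique z s (m : int) : z != 0 -> (0 < s)%N ->
  OPunit (z ^+ s * p%:R ^ (- m)) -> ordP P p z = m%:~R / s%:R.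
Proof.
move=> z0 s0 u; have hv : has_val P p z (m%:~R / s%:R).
  by exists s, m; case: u.
have [s' [m' [s'0 E' u1 u2]]] := epsilon_spec (inhabits 0) _ (ex_intro _ _ hv).
rewrite (_ : ordP P p z = m'%:~R / s'%:R) //; clear E'.
have p0 : p%:R != 0 :> algC by rewrite pnatr_eq0 -lt0n prime_gt0.
have := OPunitM (OPunitX s (conj u1 u2)) (OPunitV (OPunitX s' u)).
have -> : (z ^+ s' * p%:R ^ (- m')) ^+ s / (z ^+ s * p%:R ^ (- m)) ^+ s' =
  p%:R ^ (m * s' - m' * s).
  rewrite !exprMn invfM mulrACA -!exprM mulnC divff ?expf_neq0 // mul1r.
  by rewrite !exprnP !exprz_exp invr_expz -expfzDr //; congr (_ ^ _); ring.
move=> /OPunit_exp_int/eqP; rewrite subr_eq0 => /eqP E.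
apply/eqP; rewrite eqr_div ?pnatr_eq0 -?lt0n //.
by rewrite -[s'%:R]/(s'%:~R) -[s%:R]/(s%:~R) -!intrM E.
Qed.
End Localization.

(** * Gauss sums *)

Section AdditiveCharacter.
Variables (F : finFieldType) (p f : nat) (zeta : algC).
Hypotheses (pp : prime p) (Fq : #|F| = (p ^ f)%N) (zP : p.-primitive_root zeta).

Lemma pchar_F : p \in [pchar F].
Proof.
have [r rp rF] := finPcharP F.
have h : #|F|%:R = 0 :> F.
  by rewrite -cardsT -FinRing.zmodXgE expg_cardG ?inE.
apply/andP; split => //; move: h; rewrite Fq natrX => /eqP.
by rewrite expf_eq0 => /andP[].
Qed.
Let pF := pchar_F.

Lemma f_gt0 : (0 < f)%N.
Proof.
case: f Fq => // Fq1; have := max_card (mem [:: 0 : F; 1]); rewrite Fq1.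
by rewrite (card_uniqP _) //= inE eq_sym oner_eq0.
Qed.

Lemma pcharXnD (x y : F) i : (x + y) ^+ (p ^ i) = x ^+ (p ^ i) + y ^+ (p ^ i).
Proof. by apply: exprDn_pchar; rewrite pnatX pnatE // pF. Qed.

Local Notation tr := (ftr p f).

Lemma ftrD (x y : F) : tr (x + y) = tr x + tr y.
Proof. by rewrite /ftr -big_split; apply: eq_bigr => i _; rewrite /= pcharXnD. Qed.

Lemma ftrXp (x : F) : tr (x ^+ p) = tr x.
Proof.
rewrite /ftr; move: f_gt0 Fq; case: (f) => // g _ Fg.
rewrite big_ord_recr [RHS]big_ord_recl /= addrC.
rewrite -!exprM -expnS -Fg expf_card expn0 expr1; congr (_ + _).
by apply: eq_bigr => i _; rewrite -exprM -expnS.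
Qed.

Lemma pcharXn_sum n i (g : 'I_n -> F) :
  (\sum_(j < n) g j) ^+ (p ^ i) = \sum_(j < n) g j ^+ (p ^ i).
Proof.
elim: n g => [|n IH] g; last by rewrite !big_ord_recr /= pcharXnD IH.
by rewrite !big_ord0 expr0n expn_eq0 eqn0Ngt prime_gt0.
Qed.

Lemma ftr_Xp (x : F) : tr x ^+ p = tr x.
Proof.
rewrite -{2}ftrXp /ftr -[X in _ ^+ X]expn1 pcharXn_sum.
by apply: eq_bigr => i _; rewrite expn1 exprAC.
Qed.

Lemma eqr_nat_F (k l : nat) : (k%:R == l%:R :> F) = (k == l %[mod p]).
Proof.
wlog le : k l / (l <= k)%N.
  by move=> W; case: (leqP l k) => [|/ltnW] le; [|rewrite eq_sym [RHS]eq_sym]; apply: W.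
by rewrite eqn_mod_dvd // (dvdn_pcharf pF) natrB // subr_eq0.
Qed.

(** The default value 0 of [Fp_val] is never reached here: ['X^p - 'X] already has the [p] elements
    of the prime field as roots. *)
Lemma Fp_valP (y : F) : y ^+ p = y -> (Fp_val p y)%:R = y.
Proof.
move=> yp; rewrite /Fp_val; case: pickP => [k /eqP //|none].
pose s := [seq (nat_of_ord k)%:R : F | k <- enum 'I_p].
have us : uniq s.
  rewrite map_inj_in_uniq ?enum_uniq // => k l _ _ /eqP.
  by rewrite eqr_nat_F !modn_small // => /eqP /val_inj.
have ys : y \notin s.
  by apply/mapP => -[k _ E]; have := none k; rewrite -E eqxx.
have sz : size ('X^p - 'X : {poly F}) = p.+1.
  by rewrite size_polyDl size_polyXn // size_polyN size_polyX ltnS prime_gt1.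
have nz : 'X^p - 'X != 0 :> {poly F} by rewrite -size_poly_eq0 sz.
have rt : all (root ('X^p - 'X)) (y :: s).
  rewrite /= rootE !hornerE yp subrr eqxx /=; apply/allP => _ /mapP[k _ ->].
  by rewrite rootE !hornerE -natrX subr_eq0 eqr_nat_F fermat_little.
have := max_poly_roots nz rt; rewrite /= ys us => /(_ isT).
by rewrite sz size_map size_enum_ord ltnn.
Qed.

Local Notation psi := (psiq p f zeta).

Lemma psiqE (k : nat) (x : F) : k%:R = tr x -> psi x = zeta ^+ k.
Proof.
move=> kx; apply/eqP; rewrite /psiq (eq_prim_root_expr zP) -eqr_nat_F kx.
by rewrite Fp_valP // ftr_Xp.
Qed.

Lemma psiqD (x y : F) : psi (x + y) = psi x * psi y.
Proof.
rewrite {2 3}/psiq -exprD; apply: psiqE.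
by rewrite natrD !Fp_valP ?ftr_Xp // ftrD.
Qed.

Lemma psiqXp (x : F) : psi (x ^+ p) = psi x.
Proof. by rewrite /psiq ftrXp. Qed.

Lemma psiq0 : psi (0 : F) = 1.
Proof.
rewrite (@psiqE 0) ?expr0 // /ftr big1 // => i _.
by rewrite expr0n expn_eq0 eqn0Ngt prime_gt0.
Qed.

(** The trace is a polynomial of degree [p ^ f.-1], too small to vanish on all of [F]. *)
Lemma ftr_neq0 : exists x : F, tr x != 0.
Proof.
suff /existsP : [exists x : F, tr x != 0] by [].
apply: contraT; rewrite negb_exists => /forallP tr0.
pose T : {poly F} := \sum_(i < f) 'X^(p ^ i).
have p1 := prime_gt1 pp.
have sT : size T = (p ^ f.-1).+1.
  rewrite /T; move: f_gt0; case: (f) => // g _.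
  rewrite big_ord_recr /= addrC size_polyDl size_polyXn //.
  rewrite ltnS (leq_trans (size_sum _ _ _)) //; apply/bigmax_leqP => i _.
  by rewrite size_polyXn ltn_exp2l.
have nz : T != 0 by rewrite -size_poly_eq0 sT.
have rt : all (root T) (enum F).
  apply/allP => x _; rewrite rootE /T horner_sum.
  under eq_bigr do rewrite hornerXn.
  by have := tr0 x; rewrite negbK.
have := max_poly_roots nz rt (enum_uniq _).
rewrite -cardE Fq sT ltnS leqNgt ltn_exp2l // ?prime_gt1 //.
by rewrite prednK ?f_gt0 ?leqnn.
Qed.

Lemma psiq_nontrivial : exists x : F, psi x != 1.
Proof.
have [x tx] := ftr_neq0; exists x; rewrite /psiq -(expr0 zeta).
by rewrite (eq_prim_root_expr zP) -eqr_nat_F Fp_valP // ftr_Xp.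
Qed.

Lemma sum_psiq (y : F) : \sum_x psi (x * y) = if y == 0 then #|F|%:R else 0.
Proof.
have [->|y0] := eqVneq y 0.
  under eq_bigr do rewrite mulr0 psiq0.
  by rewrite sumr_const.
have [a a1] := psiq_nontrivial.
have inj : injective (fun x : F => x + a / y) by apply: addIr.
set S := \sum_x _; have : S = S * psi a.
  rewrite {1}/S (reindex_inj inj) mulr_suml; apply: eq_bigr => x _ /=.
  by rewrite mulrDl divfK // psiqD.
move/eqP; rewrite -{1}(mulr1 S) -subr_eq0 -mulrBr mulf_eq0 subr_eq0 [1 == _]eq_sym.
by rewrite (negPf a1) orbF => /eqP.
Qed.

Lemma sum_psiq_neq0 (y : F) : y != 0 -> \sum_(x | x != 0) psi (x * y) = -1.
Proof.
move=> y0; have := sum_psiq y; rewrite (bigD1 0) //= mul0r psiq0 (negPf y0).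
by move=> /eqP; rewrite addrC addr_eq0 => /eqP.
Qed.

End AdditiveCharacter.

(** * The Teichmueller character and products of Gauss sums *)

Section GaussSums.
Variables (p f : nat) (P : algC -> Prop) (F : finFieldType).
Variables (zeta : algC) (t : F -> algC).
Hypotheses (pp : prime p) (PP : is_prime_over p P) (Fq : #|F| = (p ^ f)%N).
Hypotheses (tP : teich P t) (zP : p.-primitive_root zeta).

Local Notation q := #|F|.
Local Notation psi := (psiq p f zeta).

Lemma q1_gt0 : (0 < q.-1)%N.
Proof. by rewrite Fq -subn1 subn_gt0 -(expn0 p) ltn_exp2l ?prime_gt1 // (f_gt0 Fq). Qed.

Lemma t0 : t 0 = 0. Proof. by case: tP. Qed.
Lemma tM x y : t (x * y) = t x * t y. Proof. by case: tP. Qed.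
Lemma t_root1 x : x != 0 -> t x ^+ q.-1 = 1. Proof. by case: tP => _ _ h _; apply: h. Qed.
Lemma tD x y : P (t (x + y) - t x - t y). Proof. by case: tP. Qed.

Lemma t_neq0 x : x != 0 -> t x != 0.
Proof.
move=> x0; apply/eqP => tx; have := t_root1 x0.
by rewrite tx expr0n gtn_eqF ?q1_gt0 // => /esym/eqP; rewrite oner_eq0.
Qed.

Lemma t1 : t 1 = 1.
Proof.
have := t_neq0 (oner_neq0 F) => n; apply: (mulfI n); by rewrite -tM !mulr1.
Qed.

Lemma tX x k : t (x ^+ k) = t x ^+ k.
Proof. by elim: k => [|k IH]; rewrite ?expr0 ?t1 // !exprS tM IH. Qed.

Lemma tV x : t x^-1 = (t x)^-1.
Proof.
have [->|x0] := eqVneq x 0; first by rewrite invr0 t0 invr0.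
apply: (mulIf (t_neq0 x0)).
by rewrite -tM !mulVf ?t1 // t_neq0.
Qed.

(** If [t x] were 1, additivity modulo [P] would put the root of unity [t (x - 1)] into [P]. This
    makes [t] injective on units. *)
Lemma t_neq1 x : x != 1 -> t x != 1.
Proof.
move=> x1; apply/eqP => tx; have x10 : x - 1 != 0 by rewrite subr_eq0.
have := tD (x - 1) 1; rewrite subrK tx t1 addrAC subrr add0r => /(primePN PP).
by rewrite opprK; apply: (primeP_root1 PP q1_gt0 (t_root1 x10)).
Qed.

Lemma t_Aint x : t x \in Aint.
Proof.
have [->|x0] := eqVneq x 0; first by rewrite t0 rpred0.
by apply: (@Aint_unity_root q.-1); rewrite ?q1_gt0 //; apply/unity_rootP/t_root1.
Qed.

Lemma tXmod x k : x != 0 -> t x ^+ (k %% q.-1) = t x ^+ k.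
Proof.
move=> x0; rewrite [in RHS](divn_eq k q.-1) exprD mulnC exprM t_root1 //.
by rewrite expr1n mul1r.
Qed.

Lemma t_nontrivial k : ~~ (q.-1 %| k)%N -> exists2 x, x != 0 & t x ^+ k != 1.
Proof.
move=> qk; set r := (k %% q.-1)%N; have r0 : (0 < r)%N by rewrite lt0n.
have rq : (r < q.-1)%N by rewrite ltn_mod q1_gt0.
suff : [exists x : F, (x != 0) && (x ^+ r != 1)].
  by move=> /existsP[x /andP[x0 xr]]; exists x; rewrite // -tXmod // -tX t_neq1.
apply: contraT; rewrite negb_exists => /forallP h.
have nz : 'X^r - 1 != 0 :> {poly F} by rewrite monic_neq0 ?monicXnsubC.
have rt : all (root ('X^r - 1)) (enum [pred x : F | x != 0]).
  apply/allP => x; rewrite mem_enum inE => x0.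
  rewrite rootE !hornerE subr_eq0; have := h x; rewrite x0 /= negbK.
  by [].
have := max_poly_roots nz rt (enum_uniq _).
by rewrite -cardE size_XnsubC // cardC1 ltnS leqNgt rq.
Qed.

Lemma sum_t k : \sum_(x | x != 0) t x ^+ k = if (q.-1 %| k)%N then q.-1%:R else 0.
Proof.
case: ifPn => [/dvdnP[m ->]|qk].
  rewrite (eq_bigr (fun=> 1)) ?sumr_const ?cardC1 // => x x0.
  by rewrite mulnC exprM t_root1 // expr1n.
have [a a0 a1] := t_nontrivial qk.
set S := \sum_(x | _) _; have : S = S * t a ^+ k.
  rewrite {1}/S (reindex_inj (mulIf a0)) mulr_suml.
  apply: eq_big => [x|x x0]; first by rewrite mulf_eq0 (negPf a0) orbF.
  by rewrite tM exprMn.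
move/eqP; rewrite -{1}(mulr1 S) -subr_eq0 -mulrBr mulf_eq0 subr_eq0 [1 == _]eq_sym.
by rewrite (negPf a1) orbF => /eqP.
Qed.

(** The Gauss sum of the character [t ^ (- b)], indexed by an exponent modulo [q.-1] so that
    products and multiplication by [p] become arithmetic on [b]. *)
Definition gsum b := - \sum_(x : F | x != 0) t x^-1 ^+ b * psi x.

Lemma gaussE d a : gauss p f zeta t d a = gsum (a * (q.-1 %/ d)).
Proof.
by congr (- _); apply: eq_bigr => x _; rewrite tV exprVn exprnN.
Qed.

Lemma sum_tV k : \sum_(x | x != 0) t x^-1 ^+ k = if (q.-1 %| k)%N then q.-1%:R else 0.
Proof.
rewrite -sum_t [RHS](reindex_inj (can_inj invrK)).
by apply: eq_bigl => x; rewrite invr_eq0.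
Qed.

Lemma gsum_mod b c : (b = c %[mod q.-1])%N -> gsum b = gsum c.
Proof.
move=> bc; congr (- _); apply: eq_bigr => x x0.
by rewrite -tXmod ?invr_eq0 // bc tXmod ?invr_eq0.
Qed.

Lemma gsum0 : gsum 0 = 1.
Proof.
rewrite /gsum -[RHS]opprK; congr (- _).
rewrite -(sum_psiq_neq0 pp Fq zP (oner_neq0 F)).
by apply: eq_bigr => x _; rewrite expr0 mul1r mulr1.
Qed.

(** Frobenius permutes [F] and preserves the trace. *)
Lemma gsumMp b : gsum (p * b) = gsum b.
Proof.
have inj : injective (fun x : F => x ^+ p).
  move=> x y xy; apply: (fmorph_inj (pFrobenius_aut (pchar_F pp Fq))).
  by rewrite /= !pFrobenius_autE.
congr (- _); rewrite [RHS](reindex_inj inj).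
apply: eq_big => [x|x x0]; first by rewrite expf_eq0 prime_gt0.
by rewrite (psiqXp _ Fq) -exprVn tX -exprM.
Qed.

Lemma gsum_mul_sum b c : gsum b * gsum c =
  \sum_(x | x != 0) \sum_(y | y != 0) t x^-1 ^+ b * t y^-1 ^+ c * psi (x + y).
Proof.
rewrite /gsum mulrNN mulr_suml; apply: eq_bigr => x _.
rewrite mulr_sumr; apply: eq_bigr => y _.
by rewrite (psiqD pp Fq zP) mulrACA.
Qed.

(** After the substitution [x = y * v] the sum over [y] is purely additive: it is [q - 1] at
    [v = -1] and [-1] elsewhere, and the constant part cancels because the character is
    nontrivial. *)
Lemma gsum_opp b c : ~~ (q.-1 %| b)%N -> (q.-1 %| b + c)%N ->
  gsum b * gsum c = t (-1) ^+ b * q%:R.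
Proof.
move=> qb /dvdnP[m bc]; rewrite gsum_mul_sum exchange_big /=.
transitivity (\sum_(y | y != 0) \sum_(v | v != 0) t v^-1 ^+ b * psi (y * (v + 1))).
  apply: eq_bigr => y y0; rewrite (reindex_inj (mulfI y0)).
  apply: eq_big => [v|v v0]; first by rewrite mulf_eq0 (negPf y0).
  rewrite mulrDr mulr1; congr (_ * _).
  rewrite invfM tM exprMn mulrAC -exprD bc mulnC exprM t_root1 ?invr_eq0 //.
  by rewrite expr1n mul1r.
rewrite exchange_big /=.
rewrite (eq_bigr (fun v => t v^-1 ^+ b * (if v == -1 then q%:R - 1 else -1))); last first.
  move=> v v0; rewrite -mulr_sumr; congr (_ * _).
  case: eqP => [->|/eqP v1]; last first.
    by rewrite (sum_psiq_neq0 pp Fq zP) // -[1]opprK subr_eq0.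
  rewrite addNr; under eq_bigr do rewrite mulr0 (psiq0 pp Fq zP).
  rewrite sumr_const cardC1 -subn1 natrB //.
  by apply/card_gt0P; exists 0.
rewrite (eq_bigr (fun v => t v^-1 ^+ b * (if v == -1 then q%:R else 0) - t v^-1 ^+ b)); last first.
  by move=> v _; case: eqP => _; ring.
rewrite sumrB sum_tV (negPf qb) subr0 (bigD1 (-1)) ?oppr_eq0 ?oner_neq0 //= eqxx.
rewrite big1 ?addr0 ?invrN1 // => v /andP[_ v1].
by rewrite (negPf v1) mulr0.
Qed.

(** The factor [J] is, up to sign, a classical Jacobi sum in two characters; only its integrality is
    recorded. The terms with [x + y = 0] cancel since the product character is nontrivial. *)
Lemma gsum_mul b c : ~~ (q.-1 %| b + c)%N ->
  exists2 J, J \in Aint & gsum b * gsum c = J * gsum (b + c).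
Proof.
move=> qbc.
pose J := - \sum_(u | (u != 0) && (1 - u != 0)) t u^-1 ^+ b * t (1 - u)^-1 ^+ c.
have tA x k : t x ^+ k \in Aint by rewrite rpredX // t_Aint.
exists J; first by rewrite rpredN rpred_sum // => u _; rewrite rpredM.
rewrite gsum_mul_sum.
transitivity (\sum_(x | x != 0) \sum_(s | s - x != 0)
    t x^-1 ^+ b * t (s - x)^-1 ^+ c * psi s).
  apply: eq_bigr => x _; rewrite (reindex_inj (addIr (- x))).
  by apply: eq_bigr => s _; rewrite /= [x + _]addrC subrK.
rewrite (exchange_big_dep xpredT) //= (bigD1 0) //=.
rewrite [X in X + _](_ : _ = 0) ?add0r; last first.
  rewrite (eq_bigr (fun x => t (-1) ^+ c * t x^-1 ^+ (b + c))).
    rewrite (eq_bigl (fun x => x != 0)).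
      by rewrite -mulr_sumr sum_tV (negPf qbc) mulr0.
    by move=> x; rewrite sub0r oppr_eq0 andbb.
  move=> x _; rewrite (psiq0 pp Fq zP) mulr1 sub0r -[- x]mulN1r invfM tM exprMn invrN1.
  by rewrite exprD mulrCA.
rewrite /J /gsum mulrNN mulr_sumr; apply: eq_bigr => s s0.
rewrite (reindex_inj (mulfI s0)) mulr_suml.
apply: eq_big => [u|u _].
  by rewrite -{2}(mulr1 s) -mulrBr !mulf_eq0 (negPf s0).
rewrite -{2}(mulr1 s) -mulrBr !invfM !tM !exprMn exprD; ring.
Qed.

End GaussSums.

(** * Valuations of Gauss and Jacobi sums *)

Section GaussValuation.
Variables (p f : nat) (P : algC -> Prop) (F : finFieldType).
Variables (zeta : algC) (t : F -> algC).
Hypotheses (pp : prime p) (PP : is_prime_over p P) (Fq : #|F| = (p ^ f)%N).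
Hypotheses (tP : teich P t) (zP : p.-primitive_root zeta).

Local Notation q := #|F|.
Local Notation psi := (psiq p f zeta).
Local Notation G := (gsum p f zeta t).
Local Notation OPu := (OPunit P).

Let zA : zeta \in Aint := Aint_prim_root zP.
Let pi := 1 - zeta.

Lemma prod_one_sub_prim : \prod_(1 <= i < p) (1 - zeta ^+ i) = p%:R.
Proof.
have E : \prod_(1 <= i < p) ('X - (zeta ^+ i)%:P) = \sum_(i < p) 'X^i :> {poly algC}.
  apply: (@mulfI _ ('X - 1)); first by rewrite polyXsubC_eq0.
  rewrite -[RHS]subrX1 -(factor_Xn_sub_1 zP) (big_ltn (prime_gt0 pp)).
  by rewrite expr0.
have := congr1 (horner^~ 1) E.
rewrite horner_prod horner_sum.
under eq_bigr do rewrite hornerXsubC.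
move=> ->; under eq_bigr do rewrite hornerXn expr1n.
by rewrite sumr_const card_ord.
Qed.

Lemma one_sub_zetaX i : 1 - zeta ^+ i = pi * \sum_(j < i) zeta ^+ j.
Proof. by rewrite /pi -opprB subrX1 -mulNr opprB. Qed.

Lemma primeP_prod (r : seq nat) (a : nat -> algC) : (forall i, a i \in Aint) ->
  P (\prod_(i <- r) a i) -> exists2 i, i \in r & P (a i).
Proof.
move=> aA; elim: r => [|j r IH]; first by rewrite big_nil => /(primeP1 PP).
rewrite big_cons => /(primeP_mul PP) -[//||Pa|/IH[i ir Pi]].
- by rewrite rpred_prod.
- by exists j; rewrite ?mem_head.
- by exists i; rewrite // inE ir orbT.
Qed.

(** Some factor [1 - zeta ^+ i] of [p] lies in [P], and [pi] is an integral multiple of it because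
    [zeta] is a power of [zeta ^+ i]. *)
Lemma primeP_one_sub_zeta : P pi.
Proof.
have A i : 1 - zeta ^+ i \in Aint by rewrite rpredB ?rpred1 ?rpredX.
have := primePp PP; rewrite -prod_one_sub_prim => /(primeP_prod A)[i].
rewrite mem_index_iota => /andP[i1 ip] Pi.
have cpi : gcdn i p = 1%N.
  by apply/eqP; rewrite -/(coprime i p) coprime_sym prime_coprime // gtnNdvd.
have [u v E _] := egcdnP p i1.
have -> : pi = (\sum_(j < u) (zeta ^+ i) ^+ j) * (1 - zeta ^+ i).
  rewrite mulrC -opprB mulNr -subrX1 opprB -exprM mulnC E cpi exprD mulnC exprM.
  by rewrite (prim_expr_order zP) expr1n mul1r expr1.
by apply: (primePM PP) => //; rewrite rpred_sum // => j _; rewrite !rpredX.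
Qed.

Lemma pi_neq0 : pi != 0.
Proof.
rewrite /pi subr_eq0 eq_sym -{1}(expr1 zeta) -(expr0 zeta) (eq_prim_root_expr zP).
by rewrite !modn_small ?prime_gt1 ?prime_gt0.
Qed.

Lemma primeP_one_sub_zetaX i : P (1 - zeta ^+ i).
Proof.
rewrite one_sub_zetaX mulrC; apply: (primePM PP) primeP_one_sub_zeta.
by rewrite rpred_sum // => j _; rewrite rpredX.
Qed.

Lemma geom_zeta_Aint i : \sum_(j < i) zeta ^+ j \in Aint.
Proof. by rewrite rpred_sum // => j _; rewrite rpredX. Qed.

Lemma geom_zeta_congr i : P (i%:R - \sum_(j < i) zeta ^+ j).
Proof.
have -> : i%:R = \sum_(j < i) 1 :> algC by rewrite sumr_const card_ord.
rewrite -sumrB; apply: (primeP_sum PP) => j _; exact: primeP_one_sub_zetaX.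
Qed.

(** Each quotient of [1 - zeta ^+ i] by [pi] is congruent to [i] modulo [P], hence a unit for
    [0 < i < p]. *)
Lemma OPunit_p_pi : OPu (p%:R / pi ^+ p.-1).
Proof.
rewrite -prod_one_sub_prim big_nat.
rewrite (eq_bigr (fun i => pi * \sum_(j < i) zeta ^+ j)); last first.
  by move=> i _; rewrite one_sub_zetaX.
rewrite -big_nat big_split /= prodr_const_nat subn1 mulrAC divff ?mul1r; last first.
  by rewrite expf_neq0 // pi_neq0.
rewrite big_nat; elim/big_rec: _ => [|i x /andP[i1 ip] ux].
  exact: OPunit1 PP.
apply: (OPunitM PP) => //; apply: (Aint_OPunit PP); first exact: geom_zeta_Aint.
move=> Pg; have : P i%:R.
  by rewrite -[i%:R](subrK (\sum_(j < i) zeta ^+ j)); apply: (primePD PP) (geom_zeta_congr i) Pg.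
by move=> /(primeP_nat pp PP); rewrite gtnNdvd.
Qed.

Lemma t_nat_congr (k : nat) : P (t k%:R - k%:R).
Proof.
elim: k => [|k IH]; first by rewrite mulr0n (t0 tP) subr0; apply: (primeP0 PP).
rewrite !mulrSr.
have -> : t (k%:R + 1) - (k%:R + 1) = (t (k%:R + 1) - t k%:R - t 1) + (t k%:R - k%:R).
  by rewrite (t1 pp Fq tP); ring.
by apply: (primePD PP) => //; apply: (tD tP).
Qed.

Lemma t_sum_congr n (g : 'I_n -> F) : P (t (\sum_i g i) - \sum_i t (g i)).
Proof.
elim: n g => [|n IH] g.
  by rewrite !big_ord0 (t0 tP) subr0; apply: (primeP0 PP).
rewrite !big_ord_recr /=; set A := \sum_(i < n) _; set B := \sum_(i < n) _.
have -> : t (A + g ord_max) - (B + t (g ord_max)) =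
   (t (A + g ord_max) - t A - t (g ord_max)) + (t A - B) by ring.
by apply: (primePD PP); [apply: (tD tP) | apply: IH].
Qed.

(** The base case of Stickelberger's theorem. Subtracting the vanishing character sum allows [pi] to
    be factored out, and the cofactor [U] is congruent to [q - 1], that is to [-1], modulo [P]. *)
Lemma gsum1 : (1 < q.-1)%N -> OPu (G 1 / pi).
Proof.
move=> q1; pose S k : algC := \sum_(j < k) zeta ^+ j.
pose k x := Fp_val p (ftr p f x : F).
pose U := \sum_(x | x != 0) t x^-1 * S (k x).
have E : G 1 = pi * U.
  rewrite /pi /U mulr_sumr /gsum.
  have -> : - \sum_(x | x != 0) t x^-1 ^+ 1 * psi x =
     \sum_(x | x != 0) t x^-1 ^+ 1 - \sum_(x | x != 0) t x^-1 ^+ 1 * psi x.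
    by rewrite (sum_tV pp PP Fq tP) dvdn1 gtn_eqF // sub0r.
  rewrite -sumrB; apply: eq_bigr => x _.
  by rewrite expr1 mulrCA -one_sub_zetaX mulrBr mulr1.
have UA : U \in Aint.
  by rewrite rpred_sum // => x _; rewrite rpredM ?(t_Aint pp Fq tP) ?geom_zeta_Aint.
rewrite E mulrAC divff ?pi_neq0 // mul1r; apply: (Aint_OPunit PP) => // PU.
(* Modulo [P], [S (k x)] is the lifted trace [\sum_i t x ^+ (p ^ i)]. Against [t x^-1] only [i = 0]
   survives, since [(p ^ i).-1] lies strictly between 0 and [q.-1] for the other [i]. *)
have PD : P (q.-1%:R - U).
  have -> : q.-1%:R = \sum_(x | x != 0) t x^-1 * \sum_(i < f) t x ^+ (p ^ i).
    under eq_bigr do rewrite mulr_sumr.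
    rewrite exchange_big /=.
    have f0 := f_gt0 Fq.
    rewrite (bigD1 (Ordinal f0)) //= [X in _ + X]big1 ?addr0.
      rewrite (eq_bigr (fun=> 1)) ?sumr_const ?cardC1 // => x x0.
      by rewrite expr1 (tV pp Fq tP) mulVf // (t_neq0 pp Fq tP).
    move=> i i0.
    rewrite (eq_bigr (fun x => t x ^+ (p ^ i).-1)).
      rewrite (sum_t pp PP Fq tP) gtnNdvd //.
        rewrite -subn1 subn_gt0 -(expn0 p) ltn_exp2l ?prime_gt1 // lt0n.
        by move: i0; rewrite -val_eqE.
      have : (p ^ i < q)%N by rewrite Fq ltn_exp2l ?prime_gt1.
      have : (0 < p ^ i)%N by rewrite expn_gt0 prime_gt0.
      lia.
    move=> x x0; rewrite -{1}[(p ^ i)%N]prednK ?expn_gt0 ?prime_gt0 // exprS mulrA.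
    by rewrite (tV pp Fq tP) mulVf ?mul1r // (t_neq0 pp Fq tP).
  rewrite -sumrB; apply: (primeP_sum PP) => x _; rewrite -mulrBr.
  apply: (primePM PP); first exact: t_Aint pp Fq tP _.
  have -> : \sum_(i < f) t x ^+ (p ^ i) - S (k x) =
     ((k x)%:R - S (k x)) + (t (k x)%:R - (k x)%:R)
       - (t (ftr p f x) - \sum_(i < f) t x ^+ (p ^ i)).
    by rewrite (Fp_valP pp Fq (ftr_Xp pp Fq x)); ring.
  apply: (primePB PP).
    apply: (primePD PP); first exact: geom_zeta_congr.
    exact: t_nat_congr.
  rewrite /ftr; under [X in _ - X]eq_bigr do rewrite -(tX pp Fq tP).
  exact: t_sum_congr.
have Pq1 : P q.-1%:R by rewrite -[q.-1%:R](subrK U); apply: (primePD PP).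
move: Pq1 => /(primeP_nat pp PP) pq1.
have : (p %| q.-1.+1)%N.
  rewrite prednK ?Fq ?expn_gt0 ?prime_gt0 //.
  by rewrite -(prednK (f_gt0 Fq)) expnS dvdn_mulr.
by rewrite -addn1 dvdn_addr // dvdn1 gtn_eqF ?prime_gt1.
Qed.

End GaussValuation.

(** * Stickelberger's formula for the valuation *)

Section GaussValuationExact.
Variables (p f : nat) (P : algC -> Prop) (F : finFieldType).
Variables (zeta : algC) (t : F -> algC).
Hypotheses (pp : prime p) (PP : is_prime_over p P) (Fq : #|F| = (p ^ f)%N).
Hypotheses (tP : teich P t) (zP : p.-primitive_root zeta).
Local Notation q := #|F|.
Local Notation psi := (psiq p f zeta).
Local Notation G := (gsum p f zeta t).
Local Notation OPu := (OPunit P).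
Let pi := 1 - zeta.

(** This is [q.-1] times the sum of the fractional parts of [p ^ j * b / q.-1]. For [b < q.-1] it is
    also [q.-1 / p.-1] times the base-[p] digit sum of [b]. *)
Definition frob_sum b := (\sum_(j < f) (p ^ j * b) %% q.-1)%N.

Lemma q1E : (q.-1 = p.-1 * \sum_(i < f) p ^ i)%N.
Proof. by rewrite Fq predn_exp. Qed.

Lemma frob_sumMp b : frob_sum (p * b) = frob_sum b.
Proof.
rewrite /frob_sum; have := f_gt0 Fq.
have qb : (p ^ f * b = b %[mod q.-1])%N.
  have q0 : (0 < q)%N by rewrite Fq expn_gt0 prime_gt0.
  by rewrite -Fq -{1}(prednK q0) mulSn addnC mulnC modnMDl.
move: qb; case: (f) => // g qb _.
rewrite big_ord_recr [RHS]big_ord_recl /= addnC mulnA -expnSr qb expn0 mul1n.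
by congr (_ + _)%N; apply: eq_bigr => i _; rewrite mulnA -expnSr.
Qed.

(** Multiplication by [p ^ j] modulo [q.-1] rotates the base-[p] digits: [x * B + y] becomes
    [x + y * A]. As [p] divides [B] but not [b], the low part [y] is positive, so passing to [b.-1]
    lowers only [y]. *)
Lemma mod_frob_pred j b : (j < f)%N -> (0 < b < q.-1)%N -> ~~ (p %| b)%N ->
  ((p ^ j * b) %% q.-1 = (p ^ j * b.-1) %% q.-1 + p ^ j)%N.
Proof.
move=> jf /andP[b0 bq] pb.
pose A := (p ^ j)%N; pose B := (p ^ (f - j))%N.
have AB : (A * B = q)%N by rewrite -expnD subnKC ?Fq // ltnW.
have A0 : (0 < A)%N by rewrite expn_gt0 prime_gt0.
have B0 : (0 < B)%N by rewrite expn_gt0 prime_gt0.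
have pB : (p %| B)%N by rewrite /B -(subnSK jf) expnS dvdn_mulr.
have : (b = (b %/ B) * B + b %% B)%N := divn_eq b B.
have yB : (b %% B < B)%N by rewrite ltn_pmod.
have y0 : (0 < b %% B)%N.
  rewrite lt0n; apply: contra pb => /(dvdn_trans pB); exact.
move: (b %/ B)%N (b %% B)%N yB y0 => x y yB y0 bE.
have xA : (x < A)%N.
  rewrite -(ltn_pmul2r B0) AB; apply: leq_ltn_trans (_ : (x * B <= b)%N) _.
    by rewrite bE leq_addr.
  by rewrite (leq_trans bq) // leq_pred.
have rot : (x + y * A < q.-1)%N.
  rewrite -AB; move: bq; rewrite -AB bE => bq; nia.
have modE z : (A * (x * B + z) = x + z * A %[mod q.-1])%N.
  rewrite mulnDr mulnCA AB (mulnC A z).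
  have q0 : (0 < q)%N by rewrite Fq expn_gt0 prime_gt0.
  by rewrite -{1}(prednK q0) mulnS -addnA addnCA modnMDl.
have -> : (p ^ j * b %% q.-1 = x + y * A)%N by rewrite bE modE modn_small.
have -> : b.-1 = (x * B + y.-1)%N by rewrite bE -{1}(prednK y0) addnS.
have yE : (y.-1 * A + A = y * A)%N by rewrite -mulSnr prednK.
rewrite -/A modE modn_small -?addnA ?yE //.
by apply: leq_ltn_trans rot; rewrite leq_add2l leq_mul2r leq_pred orbT.
Qed.

Lemma frob_sum_mod b c : (b = c %[mod q.-1])%N -> frob_sum b = frob_sum c.
Proof.
by move=> bc; apply: eq_bigr => j _; rewrite -modnMmr bc modnMmr.
Qed.

Lemma frob_sum_pred b : (0 < b < q.-1)%N -> ~~ (p %| b)%N ->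
  frob_sum b = (frob_sum b.-1 + \sum_(j < f) p ^ j)%N.
Proof.
by move=> bq pb; rewrite -big_split; apply: eq_bigr => j _; rewrite mod_frob_pred.
Qed.

Lemma coprime_p_q1 : coprime p q.-1.
Proof.
rewrite prime_coprime //; apply/negP => pq1.
have q0 : (0 < q)%N by rewrite Fq expn_gt0 prime_gt0.
have : (p %| q.-1.+1)%N.
  by rewrite prednK // Fq -(prednK (f_gt0 Fq)) expnS dvdn_mulr.
by rewrite -addn1 dvdn_addr // dvdn1 gtn_eqF ?prime_gt1.
Qed.

Lemma frob_sum_opp b : (0 < b < q.-1)%N ->
  (frob_sum b + frob_sum (q.-1 - b) = f * q.-1)%N.
Proof.
move=> /andP[b0 bq]; rewrite -big_split /=.
rewrite -[f in RHS]card_ord -sum_nat_const; apply: eq_bigr => j _.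
have qj : coprime q.-1 (p ^ j) by rewrite coprimeXr // coprime_sym coprime_p_q1.
have q10 := q1_gt0 pp Fq.
set x := (p ^ j * b %% q.-1)%N.
have x0 : (0 < x)%N by rewrite lt0n -/(dvdn _ _) Gauss_dvdr // gtnNdvd.
have xq : (x < q.-1)%N by rewrite ltn_mod.
rewrite -[RHS](subnKC (ltnW xq)); congr (_ + _)%N.
have lt : (q.-1 - x < q.-1)%N by rewrite ltn_subrL x0.
rewrite -[RHS](modn_small lt); apply/eqP; rewrite -(eqn_modDr x) subnK 1?ltnW //.
by rewrite modnn modnDmr -mulnDr subnK 1?ltnW // modnMl.
Qed.

Lemma gsum_opp_small b : (0 < b < q.-1)%N ->
  G b * G (q.-1 - b) = t (-1) ^+ b * q%:R.
Proof.
move=> /andP[b0 bq]; apply: (gsum_opp pp PP Fq tP zP); first by rewrite gtnNdvd.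
by rewrite subnKC 1?ltnW.
Qed.

Lemma tN1_neq0 b : t (-1) ^+ b != 0.
Proof. by rewrite expf_neq0 // (t_neq0 pp Fq tP) // oppr_eq0 oner_neq0. Qed.

Lemma q_neq0 : q%:R != 0 :> algC.
Proof. by rewrite pnatr_eq0 Fq expn_eq0 eqn0Ngt prime_gt0. Qed.

Lemma gsum_neq0 b : (b < q.-1)%N -> G b != 0.
Proof.
move=> bq; have [->|b0] := posnP b; first by rewrite (gsum0 t pp Fq zP) oner_neq0.
apply/eqP => Gb; have := gsum_opp_small (b := b); rewrite b0 bq Gb mul0r.
by move=> /(_ isT)/esym/eqP; rewrite mulf_eq0 (negPf (tN1_neq0 b)) (negPf q_neq0).
Qed.

(* Peeling off one unit of the lowest nonzero [p]-adic digit of [b] multiplies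
   [G b] by [G 1 / J] with [J] an integer, so the valuation of [G b] is at most
   that of [pi ^+ D], [D] the digit sum; [gsum_opp_small] then forces equality. *)
Lemma gsum_upper b : (b < q.-1)%N -> exists D : nat,
  (p.-1 * frob_sum b = q.-1 * D)%N /\ in_OP P (pi ^+ D / G b).
Proof.
have [m] := ubnP b; elim: m b => // m IH b /ltnSE bm bq.
have [b0|b0] := posnP b.
  exists 0%N; rewrite b0 muln0 (gsum0 t pp Fq zP) expr0 divr1; split.
    by rewrite /frob_sum big1 ?muln0 // => i _; rewrite muln0 mod0n.
  by apply: (Aint_in_OP PP); rewrite rpred1.
(* A vanishing lowest digit is removed by Frobenius, which changes neither the Gauss sum nor
   [frob_sum]. *)
have [/dvdnP[c]|pb] := boolP (p %| b)%N.
  rewrite mulnC => bE.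
  have cb : (c < b)%N.
    by rewrite bE ltn_Pmull ?prime_gt1 //; move: b0; rewrite bE muln_gt0 => /andP[].
  have [D [VD GD]] := IH c (leq_trans cb bm) (ltn_trans cb bq).
  by exists D; rewrite bE frob_sumMp (gsumMp zeta pp Fq tP).
have cb : (b.-1 < b)%N by rewrite prednK.
have [D [VD GD]] := IH _ (leq_trans cb bm) (ltn_trans cb bq).
exists D.+1; split.
  by rewrite frob_sum_pred ?b0 // mulnDr VD -q1E // mulnS addnC.
have b1q : ~~ (q.-1 %| b.-1 + 1)%N by rewrite addn1 prednK // gtnNdvd.
have [J JA] := gsum_mul pp PP Fq tP zP b1q; rewrite addn1 prednK // => GJ.
have q11 : (1 < q.-1)%N by apply: leq_ltn_trans bq.
have -> : pi ^+ D.+1 / G b = (pi ^+ D / G b.-1) * (G 1 / pi)^-1 * J.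
  have Gb := gsum_neq0 bq; have Gb1 := gsum_neq0 (ltn_trans cb bq).
  have G1 := gsum_neq0 q11; have p0 := pi_neq0 pp zP.
  apply: (mulfI Gb1); apply: (mulfI G1); apply: (mulIf Gb).
  rewrite exprS.
  transitivity (pi ^+ D * pi * (G b.-1 * G 1)); first by field; rewrite ?Gb.
  by rewrite GJ; field; rewrite ?Gb1 ?G1 ?Gb ?p0.
apply: (in_OP_M PP); last exact: (Aint_in_OP PP).
by apply: (in_OP_M PP) => //; have [] := gsum1 pp PP Fq tP zP q11.
Qed.

(** The one-sided bounds for [b] and [q.-1 - b] have digit sums adding up to [f * p.-1], the order
    of [q] in powers of [pi]. Hence the product of the two quotients is a unit, and so is each of
    them. *)
Lemma gsum_exact b : (0 < b < q.-1)%N -> exists D : nat,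
  (p.-1 * frob_sum b = q.-1 * D)%N /\ OPu (G b ^+ p.-1 / p%:R ^+ D).
Proof.
move=> bq; have /andP[b0 lbq] := bq.
have lcq : (q.-1 - b < q.-1)%N by rewrite ltn_subrL b0 (q1_gt0 pp Fq).
have [D [VD GD]] := gsum_upper lbq; have [E [VE GE]] := gsum_upper lcq.
have DE : (D + E = f * p.-1)%N.
  apply/eqP; rewrite -(eqn_pmul2l (q1_gt0 pp Fq)) mulnDr -VD -VE -mulnDr.
  by rewrite frob_sum_opp // mulnCA mulnA mulnC mulnA.
have p0 := pi_neq0 pp zP; have Gb := gsum_neq0 lbq; have Gc := gsum_neq0 lcq.
have pC0 : p%:R != 0 :> algC by rewrite pnatr_eq0 -lt0n prime_gt0.
have uprod : OPu ((pi ^+ D / G b) * (pi ^+ E / G (q.-1 - b))).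
  rewrite mulrACA -invfM gsum_opp_small // -exprD DE invfM.
  have -> : pi ^+ (f * p.-1) * ((t (-1) ^+ b)^-1 / q%:R) =
     (t (-1) ^+ b)^-1 * (p%:R / pi ^+ p.-1) ^- f.
    rewrite mulnC exprM Fq natrX expr_div_n invf_div.
    by rewrite mulrCA.
  apply: (OPunitM PP); apply: OPunitV; last first.
    apply: (OPunitX PP); exact: OPunit_p_pi pp PP zP.
  apply: (OPunitX PP); apply: (root1_OPunit PP (q1_gt0 pp Fq)).
  by apply: (t_root1 tP); rewrite oppr_eq0 oner_neq0.
have uD : OPu (pi ^+ D / G b).
  split=> //; have -> : (pi ^+ D / G b)^-1 = (pi ^+ E / G (q.-1 - b)) *
    ((pi ^+ D / G b) * (pi ^+ E / G (q.-1 - b)))^-1.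
    by rewrite [(_ * (pi ^+ E / _))^-1]invfM mulrCA divff ?mulr1 // mulf_neq0 ?expf_neq0 ?invr_eq0.
  by apply: (in_OP_M PP) => //; case: uprod.
exists D; split => //.
have -> : G b ^+ p.-1 / p%:R ^+ D = (pi ^+ D / G b) ^- p.-1 * (p%:R / pi ^+ p.-1) ^- D.
  by rewrite !expr_div_n !invf_div [pi ^+ p.-1 ^+ D]exprAC mulrA divfK // !expf_neq0.
apply: (OPunitM PP); apply: OPunitV; apply: (OPunitX PP) => //.
exact: OPunit_p_pi pp PP zP.
Qed.

Lemma gsum_val b : ~~ (q.-1 %| b)%N -> exists D : nat,
  [/\ (p.-1 * frob_sum b = q.-1 * D)%N, G b != 0 & OPu (G b ^+ p.-1 / p%:R ^+ D)].
Proof.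
move=> qb; pose c := (b %% q.-1)%N.
have bc : (b = c %[mod q.-1])%N by rewrite modn_mod.
have cq : (0 < c < q.-1)%N by rewrite lt0n qb ltn_mod (q1_gt0 pp Fq).
rewrite (gsum_mod p f zeta tP bc) (frob_sum_mod bc).
have [D [VD uD]] := gsum_exact cq; exists D; split=> //.
by apply: gsum_neq0; case/andP: cq.
Qed.

Lemma ordP_gsum b : ~~ (q.-1 %| b)%N ->
  ordP P p (G b) = (frob_sum b)%:R / q.-1%:R.
Proof.
move=> /gsum_val[D [VD Gb uD]].
have p10 : (0 < p.-1)%N by rewrite -subn1 subn_gt0 prime_gt1.
rewrite (@ordP_unique p P pp PP _ p.-1 D) -?exprnN //.
apply/eqP; rewrite eqr_div ?pnatr_eq0 -?lt0n ?(q1_gt0 pp Fq) //.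
by rewrite -[D%:~R]/(D%:R) -!natrM eqr_nat mulnC [X in _ == X]mulnC VD.
Qed.

(** * Jacobi sums as products of Gauss sums *)

Section JacobiSum.
Variables (n : nat) (b : 'I_n -> nat).
Hypotheses (n0 : (0 < n)%N) (qb : forall i, ~~ (q.-1 %| b i)%N).
Hypothesis (qsb : (q.-1 %| \sum_i b i)%N).

Definition jsum := \sum_(x : {ffun 'I_n -> F} |
    [forall i, x i != 0] && (\sum_i x i == 0)) \prod_i t (x i)^-1 ^+ b i.

Lemma psiq_sum (I : finType) (g : I -> F) :
  psi (\sum_i g i) = \prod_i psi (g i).
Proof.
elim/big_rec2: _ => [|i y x _ IH]; first by rewrite (psiq0 pp Fq zP).
by rewrite (psiqD pp Fq zP) IH.
Qed.

(* The condition [\sum_i x i = 0] is detected by averaging [psi (u * \sum_i x i)]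
   over [u]; for [u != 0] the sum over [x] factors into Gauss sums. *)
Lemma jsum_gsum : q%:R * jsum = q.-1%:R * \prod_i - G (b i).
Proof.
transitivity (\sum_(x : {ffun 'I_n -> F} | [forall i, x i != 0])
   \sum_u \prod_i (t (x i)^-1 ^+ b i * psi (u * x i))).
  rewrite /jsum big_mkcondr mulr_sumr; apply: eq_bigr => x _.
  transitivity ((\prod_i t (x i)^-1 ^+ b i) * \sum_u psi (u * \sum_i x i)).
    rewrite (sum_psiq pp Fq zP); case: ifP => _; last by rewrite !mulr0.
    by rewrite mulrC.
  rewrite mulr_sumr; apply: eq_bigr => u _.
  by rewrite mulr_sumr psiq_sum -big_split.
rewrite exchange_big /=.
transitivity (\sum_u \prod_i \sum_(y | y != 0) t y^-1 ^+ b i * psi (u * y)).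
  apply: eq_bigr => u _.
  rewrite (bigA_distr_big_dep (fun _ y => y != 0)
    (fun i y => t y^-1 ^+ b i * psi (u * y))).
  by apply: eq_bigl => x; apply/forallP/familyP.
(* At [u = 0] each factor is the full sum of a nontrivial character, so the term vanishes. *)
rewrite (bigD1 0) //= [X in X + _](_ : _ = 0) ?add0r; last first.
  rewrite (bigD1 (Ordinal n0)) //=.
  rewrite [X in X * _](_ : _ = 0) ?mul0r // -[RHS](_ : (if (q.-1 %| b (Ordinal n0))%N
     then q.-1%:R else 0) = 0); last by rewrite (negPf (qb _)).
  rewrite -(sum_tV pp PP Fq tP); apply: eq_bigr => y _.
  by rewrite mul0r (psiq0 pp Fq zP) mulr1.
rewrite -[q.-1%:R]mulr1 -(cardC1 (0 : F)) -sumr_const !mulr_suml mul1r.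
apply: eq_big => [u|u u0]; first by rewrite inE.
(* Scaling [y] by [u^-1] extracts [t u ^+ b i]; the product of these over [i] is 1 because [q.-1]
   divides the sum of the exponents. *)
transitivity (\prod_i (t u ^+ b i * - G (b i))).
  apply: eq_bigr => i _; rewrite /gsum opprK mulr_sumr.
  have ui : u^-1 != 0 by rewrite invr_eq0.
  rewrite (reindex_inj (mulfI ui)).
  apply: eq_big => [y|y _]; first by rewrite mulf_eq0 (negPf ui).
  by rewrite mulVKf // invfM invrK (tM tP) exprMn mulrA.
rewrite big_split /= -(expr_sum (t u)).
have /dvdnP[m ->] := qsb; rewrite mulnC exprM (t_root1 tP) //.
by rewrite expr1n mul1r.
Qed.

Lemma ordP_jsum :
  ordP P p (q.-1%:R^-1 * jsum) =
  \sum_i (frob_sum (b i))%:R / q.-1%:R - f%:R.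
Proof.
have q10 : q.-1%:R != 0 :> algC by rewrite pnatr_eq0 -lt0n (q1_gt0 pp Fq).
have -> : q.-1%:R^-1 * jsum = q%:R^-1 * \prod_i - G (b i).
  by apply: (mulfI q_neq0); rewrite mulrCA jsum_gsum mulKf // mulVKf // q_neq0.
have [D HD] := fin_all_exists (fun i => gsum_val (qb i)).
have p10 : (0 < p.-1)%N by rewrite -subn1 subn_gt0 prime_gt1.
have pC0 : p%:R != 0 :> algC by rewrite pnatr_eq0 -lt0n prime_gt0.
(* Valuations are read off from [p.-1]-th powers, so the division by [q = p ^ f] costs
   [f * p.-1]. *)
rewrite (@ordP_unique p P pp PP _ p.-1 (Posz (\sum_i D i) - Posz (f * p.-1))) //.
- rewrite intrB -![(Posz _)%:~R]/(_%:R) mulrBl natrM mulfK ?pnatr_eq0 -?lt0n //.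
  congr (_ - _); rewrite natr_sum mulr_suml; apply: eq_bigr => i _.
  have [VD _ _] := HD i.
  apply/eqP; rewrite eqr_div ?pnatr_eq0 -?lt0n ?(q1_gt0 pp Fq) //.
  by rewrite -!natrM eqr_nat mulnC [X in _ == X]mulnC VD.
- rewrite mulf_neq0 ?invr_eq0 ?q_neq0 //; apply/prodf_neq0 => i _.
  by rewrite oppr_eq0; case: (HD i).
- rewrite opprB expfzDr // -exprnN exprMn mulrACA.
  rewrite [X in OPu (X * _)](_ : _ = 1) ?mul1r; last first.
    by rewrite Fq natrX exprVn -exprM mulVf // expf_neq0.
  rewrite expr_sum -prodrXl -prodf_div; elim/big_rec: _ => [|i x _ ux].
    exact: OPunit1 PP.
  apply: (OPunitM PP) => //; rewrite exprNn -mulrA; apply: (OPunitM PP).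
    by apply: (OPunitX PP); apply: (OPunitN PP); apply: (OPunit1 PP).
  by case: (HD i).
Qed.
End JacobiSum.
End GaussValuationExact.

(** * Galois action and stabilizers *)

Lemma card_le_fibers (T : finType) (V : eqType) (g : T -> V) (s : seq V) K :
  (forall u, g u \in s) -> (forall u, #|[set v | g v == g u]| <= K)%N ->
  (#|T| <= size s * K)%N.
Proof.
move=> gs gK; rewrite -sum1_card -(sum1_size s) big_distrl /=.
apply: (@leq_trans (\sum_u \sum_(y <- s) (g u == y))).
  apply: leq_sum => u _; have /splitPr[s1 s2] := gs u.
  by rewrite big_cat big_cons eqxx /= addnCA.
rewrite exchange_big /=; apply: leq_sum => y _; rewrite mul1n.
rewrite -big_mkcond sum1dep_card.
have [-> //|[u]] := set_0Vmem [set v | g v == y]; first by rewrite cards0.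
by rewrite inE => /eqP <-.
Qed.

(** Common core of both parts: [x m] runs through conjugates of [x 1], and [H] is the stabilizer.
    There are at most [n] conjugates, which bounds its index. It contains [p], so translating by
    each [p ^ j] leaves the sum of [B] over [H] unchanged. *)
Lemma small_degree_average (d n p f : nat) (x : nat -> algC) (Q : {poly algC}) :
  (1 < d)%N -> coprime p d ->
  (forall m m', (m = m' %[mod d])%N -> x m = x m') ->
  x p = x 1%N ->
  Q != 0 -> (size Q <= n.+1)%N -> root Q (x 1%N) ->
  (forall h, coprime h d -> exists2 s : {rmorphism algC -> algC},
     map_poly s Q = Q & forall m, s (x m) = x (h * m)%N) ->
  exists H : {group {unit 'Z_d}}, (totient d <= n * #|H|)%N /\
    forall (B : nat -> rat) (W : rat),
      (forall m m', (m = m' %[mod d])%N -> B m = B m') ->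
      (forall m, coprime m d -> x m = x 1%N -> \sum_(j < f) B (p ^ j * m)%N = W) ->
      W * #|H|%:R = f%:R * \sum_(h in H) B (unat h).
Proof.
move=> d1 pd xmod xp Q0 sQ Q1 gal.
have xM (u v : {unit 'Z_d}) : x (unat (u * v)%g) = x (unat u * unat v)%N.
  by apply: xmod; rewrite unatM // modn_mod.
have galu (u : {unit 'Z_d}) := gal _ (coprime_unat u d1).
have transl (u v v' : {unit 'Z_d}) :
    x (unat v) = x (unat v') -> x (unat (u * v)%g) = x (unat (u * v')%g).
  by move=> vv'; have [s _ sx] := galu u; rewrite !xM -!sx vv'.
pose S := [set u : {unit 'Z_d} | x (unat u) == x (unat (1%g : {unit 'Z_d}))].
have gS : group_set S.
  apply/group_setP; split; first by rewrite inE.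
  move=> u v; rewrite !inE => /eqP xu /eqP xv.
  by rewrite (transl u _ _ xv) mulg1 xu.
pose H := Group gS; exists H.
have rootx (u : {unit 'Z_d}) : root Q (x (unat u)).
  have [s sQs sx] := galu u; rewrite -(muln1 (unat u)) -sx -sQs fmorph_root.
  exact: Q1.
split.
  pose vals := undup [seq x (unat u) | u <- enum {: {unit 'Z_d}}].
  have xvals (u : {unit 'Z_d}) : x (unat u) \in vals by rewrite mem_undup; apply/mapP; exists u; rewrite ?mem_enum.
  have sv : (size vals <= n)%N.
    rewrite -ltnS; apply: leq_trans sQ; apply: (max_poly_roots Q0) (undup_uniq _).
    by apply/allP => y; rewrite mem_undup => /mapP[u _ ->].
  rewrite -card_unat // cardsT.
  apply: (@leq_trans (size vals * #|H|)); last by rewrite leq_mul2r sv orbT.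
  apply: (card_le_fibers xvals) => u.
  rewrite -(card_imset _ (mulgI u^-1%g)); apply: subset_leq_card.
  apply/subsetP => _ /imsetP[v + ->]; rewrite !inE => /eqP vu.
  by rewrite (transl u^-1%g _ _ vu) mulVg.
move=> B W Bmod BW.
have [up upE] := unat_onto d1 pd.
have x1 : x (unat (1%g : {unit 'Z_d})) = x 1%N by rewrite unat1.
have upH : up \in H.
  by rewrite inE x1 upE; apply/eqP; rewrite -xp; apply: xmod; rewrite modn_mod.
transitivity (\sum_(h in H) \sum_(j < f) B (p ^ j * unat h)%N).
  rewrite mulr_natr -sumr_const; apply: eq_bigr => h; rewrite inE x1 => /eqP xh.
  by rewrite (BW _ (coprime_unat h d1) xh).
rewrite exchange_big /= mulr_natl -[f in RHS]card_ord -sumr_const.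
apply: eq_bigr => j _; rewrite [RHS](reindex_inj (mulgI (up ^+ j)%g)) /=.
apply: eq_big => [h|h _]; first exact/esym/(groupMl (G := H))/groupX.
apply: Bmod; elim: (j : nat) => [|i IH]; first by rewrite expn0 mul1n mul1g.
by rewrite expnS -mulnA -modnMmr IH modnMmr expgS -mulgA (unatM up _ d1) modn_mod upE modnMml.
Qed.

(** The Chinese remainder theorem gives an exponent that is 1 modulo [p] and [h] modulo [d]; raising
    [p * d]-th roots of unity to it extends to an automorphism. *)
Lemma cyclotomic_aut (p d h : nat) (zeta : algC) :
  p.-primitive_root zeta -> coprime p d -> coprime h d ->
  exists s : {rmorphism algC -> algC},
    s zeta = zeta /\ forall w, w ^+ d = 1 -> s w = w ^+ h.
Proof.
move=> zP pd hd; pose k := chinese p d 1 h.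
have kp : (k = 1 %[mod p])%N := chinese_modl pd 1 h.
have kd : (k = h %[mod d])%N := chinese_modr pd 1 h.
have k_pd : coprime k (p * d).
  rewrite coprimeMr -coprime_modl kp coprime_modl coprime1n /=.
  by rewrite -coprime_modl kd coprime_modl.
have [s sP] := Qn_aut_exists k_pd; exists s; split=> [|w wd].
  rewrite sP; last by rewrite exprM (prim_expr_order zP) expr1n.
  by rewrite -{2}(expr1 zeta); apply/eqP; rewrite (eq_prim_root_expr zP) kp.
rewrite sP; last by rewrite mulnC exprM wd expr1n.
have mod_d j : w ^+ j = w ^+ (j %% d).
  by rewrite [in LHS](divn_eq j d) exprD mulnC exprM wd expr1n mul1r.
by rewrite mod_d kd -mod_d.
Qed.

Section Conjugates.
Variables (p f d : nat) (P : algC -> Prop) (F : finFieldType).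
Variables (zeta : algC) (t : F -> algC).
Hypotheses (pp : prime p) (PP : is_prime_over p P) (Fq : #|F| = (p ^ f)%N).
Hypotheses (tP : teich P t) (zP : p.-primitive_root zeta).
Hypotheses (pfd : (p ^ f = 1 %[mod d])%N) (d1 : (1 < d)%N).

Local Notation N := (#|F|.-1 %/ d)%N.

Lemma dvd_q1 : (d %| #|F|.-1)%N.
Proof.
have q0 : (0 < #|F|)%N by rewrite Fq expn_gt0 prime_gt0.
by rewrite -subn1 -eqn_mod_dvd // Fq pfd.
Qed.

Lemma q1_dN : (#|F|.-1 = d * N)%N.
Proof. by rewrite mulnC divnK // dvd_q1. Qed.

Lemma N_gt0 : (0 < N)%N.
Proof. by have := q1_gt0 pp Fq; rewrite {1}q1_dN muln_gt0 => /andP[]. Qed.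

Lemma coprime_p_d : coprime p d.
Proof. exact: coprime_dvdr dvd_q1 (coprime_p_q1 pp Fq). Qed.

Lemma dvd_q1_mulN b : (#|F|.-1 %| b * N)%N = (d %| b)%N.
Proof. by rewrite {1}q1_dN dvdn_pmul2r // N_gt0. Qed.

Lemma mulN_mod b c : (b = c %[mod d])%N -> (b * N = c * N %[mod #|F|.-1])%N.
Proof. by move=> bc; rewrite {2 4}q1_dN -!muln_modl bc. Qed.

Lemma frob_sum_mulN b :
  (frob_sum p f F (b * N))%:R / #|F|.-1%:R =
  \sum_(j < f) ((p ^ j * b) %% d)%N%:R / d%:R :> rat.
Proof.
rewrite /frob_sum natr_sum mulr_suml; apply: eq_bigr => j _.
rewrite mulnA {2 3}q1_dN -muln_modl !natrM -mulf_div divff ?mulr1 //.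
by rewrite pnatr_eq0 -lt0n N_gt0.
Qed.

Lemma t_mulN_root1 x b : x != 0 -> (t x ^+ (b * N)) ^+ d = 1.
Proof.
by move=> x0; rewrite -exprM -mulnA [(N * d)%N]mulnC -q1_dN mulnC exprM (t_root1 tP) ?expr1n.
Qed.

Lemma gsum_conj (s : {rmorphism algC -> algC}) h b :
  s zeta = zeta -> (forall w, w ^+ d = 1 -> s w = w ^+ h) ->
  s (gsum p f zeta t (b * N)) = gsum p f zeta t (h * b * N).
Proof.
move=> sz sh; rewrite /gsum rmorphN rmorph_sum /=; congr (- _).
apply: eq_bigr => x x0; rewrite rmorphM /=; congr (_ * _); last by rewrite /psiq rmorphXn /= sz.
by rewrite sh ?t_mulN_root1 ?invr_eq0 // -exprM mulnC mulnA.
Qed.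

Lemma jsum_conj (s : {rmorphism algC -> algC}) h w (b : 'I_w -> nat) :
  (forall z, z ^+ d = 1 -> s z = z ^+ h) ->
  s (#|F|.-1%:R^-1 * jsum t (fun i => b i * N)%N) =
  #|F|.-1%:R^-1 * jsum t (fun i => h * b i * N)%N.
Proof.
move=> sh; rewrite rmorphM fmorphV rmorph_nat /jsum rmorph_sum /=; congr (_ * _).
apply: eq_bigr => x /andP[/forallP x0 _]; rewrite rmorph_prod; apply: eq_bigr => i _.
by rewrite /= sh ?t_mulN_root1 ?invr_eq0 // -exprM mulnC mulnA.
Qed.

Lemma jacobiE w (a : 'I_w.+2 -> nat) :
  jacobi t d a = #|F|.-1%:R^-1 * jsum t (fun i => a i * N)%N.
Proof.
congr (_ * _); apply: eq_bigr => x _; apply: eq_bigr => i _.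
by rewrite (tV pp Fq tP) exprVn exprnN.
Qed.

Lemma coprime_not_dvd m b : coprime m d -> (d %| m * b)%N = (d %| b)%N.
Proof. by move=> md; rewrite Gauss_dvdr // coprime_sym. Qed.

Lemma gauss_average n a : coprime a d ->
  deg_le_over (inQzeta zeta) n (gauss p f zeta t d a) ->
  exists H : {group {unit 'Z_d}}, (totient d <= n * #|H|)%N /\
    ordP P p (gauss p f zeta t d a) * #|H|%:R =
    f%:R * \sum_(h in H) ((unat h * a) %% d)%N%:R / d%:R.
Proof.
move=> ad [Q [Q0 sQ Qz Qr]].
pose x m := gsum p f zeta t (m * a * N).
have x1 : x 1%N = gauss p f zeta t d a by rewrite /x mul1n (gaussE zeta pp Fq tP).
have xmod m m' : (m = m' %[mod d])%N -> x m = x m'.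
  move=> mm'; apply: (gsum_mod p f zeta tP); apply: mulN_mod.
  by rewrite -modnMml mm' modnMml.
have xp : x p = x 1%N by rewrite /x -!mulnA (gsumMp _ pp Fq tP) mul1n.
have Q1 : root Q (x 1%N) by rewrite x1.
have gal h : coprime h d -> exists2 s : {rmorphism algC -> algC},
    map_poly s Q = Q & forall m, s (x m) = x (h * m)%N.
  move=> hd; have [s [sz sh]] := cyclotomic_aut zP coprime_p_d hd.
  exists s; last by move=> m; rewrite /x (gsum_conj _ sz sh) mulnA.
  apply/polyP => i; rewrite coef_map /=; have [r ->] := Qz i.
  rewrite -horner_map /= sz -map_poly_comp; congr (_.[_]).
  by apply: eq_map_poly => y /=; rewrite fmorph_rat.
have [H [iH avg]] := small_degree_average f d1 coprime_p_d xmod xp Q0 sQ Q1 gal.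
exists H; split=> //.
apply: (avg (fun m => ((m * a) %% d)%N%:R / d%:R)).
  by move=> m m' mm'; rewrite -modnMml mm' modnMml.
move=> m md xm; rewrite -x1 -xm /x (ordP_gsum pp PP Fq tP zP).
  by rewrite frob_sum_mulN; apply: eq_bigr => j _; rewrite mulnA.
rewrite dvd_q1_mulN coprime_not_dvd //; apply/negP => da.
by move: ad; rewrite /coprime (gcdn_idPr da) gtn_eqF.
Qed.

Lemma jacobi_average n w (a : 'I_w.+2 -> nat) : Aprime d a ->
  deg_le_over (fun y => y \in Crat) n (jacobi t d a) ->
  exists H : {group {unit 'Z_d}}, (totient d <= n * #|H|)%N /\
    ordP P p (jacobi t d a) * #|H|%:R =
    f%:R * \sum_(h in H) (\sum_i ((unat h * a i) %% d)%N%:R / d%:R - 1).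
Proof.
move=> /andP[/andP[/forallP a0 sa] _] [Q [Q0 sQ Qz Qr]].
pose x m := #|F|.-1%:R^-1 * jsum t (fun i => m * a i * N)%N.
have x1 : x 1%N = jacobi t d a.
  by rewrite jacobiE; congr (_ * _); apply: eq_bigr => y _; apply: eq_bigr => i _; rewrite mul1n.
have qb m i : coprime m d -> ~~ (#|F|.-1 %| m * a i * N)%N.
  move=> md; rewrite dvd_q1_mulN coprime_not_dvd //.
  by have /andP[ai0 aid] := a0 i; rewrite gtnNdvd.
have xmod m m' : (m = m' %[mod d])%N -> x m = x m'.
  move=> mm'; congr (_ * _); apply: eq_bigr => y /andP[/forallP y0 _].
  apply: eq_bigr => i _; rewrite -(tXmod tP) ?invr_eq0 //.
  rewrite (mulN_mod (c := m' * a i)) ?(tXmod tP) ?invr_eq0 //.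
  by rewrite -modnMml mm' modnMml.
have qsb m : (#|F|.-1 %| \sum_i m * a i * N)%N.
  rewrite -big_distrl /= dvd_q1_mulN -big_distrr /=; exact: dvdn_mull.
(* Invariance under [p] is inherited from the Gauss sums in the product formula. *)
have xp : x p = x 1%N.
  congr (_ * _); apply: (mulfI (q_neq0 pp Fq)).
  rewrite !(jsum_gsum pp PP Fq tP zP) ?qsb //.
  - congr (_ * _); apply: eq_bigr => i _; rewrite -!mulnA (gsumMp _ pp Fq tP).
    by rewrite mul1n.
  - by move=> i; rewrite qb // coprime1n.
  - by move=> i; rewrite qb // coprime_p_d.
have Q1 : root Q (x 1%N) by rewrite x1.
have gal h : coprime h d -> exists2 s : {rmorphism algC -> algC},
    map_poly s Q = Q & forall m, s (x m) = x (h * m)%N.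
  move=> hd; have [s [_ sh]] := cyclotomic_aut zP coprime_p_d hd.
  exists s; last first.
    move=> m; rewrite /x (jsum_conj _ sh); congr (_ * _).
    by apply: eq_bigr => y _; apply: eq_bigr => i _; rewrite mulnA.
  apply/polyP => i; rewrite coef_map /=; have /CratP[r ->] := Qz i.
  by rewrite fmorph_rat.
have [H [iH avg]] := small_degree_average f d1 coprime_p_d xmod xp Q0 sQ Q1 gal.
exists H; split=> //.
apply: (avg (fun m => \sum_i ((m * a i) %% d)%N%:R / d%:R - 1)).
  move=> m m' mm'; congr (_ - _); apply: eq_bigr => i _.
  by rewrite -modnMml mm' modnMml.
move=> m md xm; rewrite -x1 -xm /x.
rewrite (ordP_jsum pp PP Fq tP zP (ltn0Sn _) (fun i => qb m i md) (qsb m)).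
under [in RHS]eq_bigr do rewrite frob_sum_mulN.
rewrite exchange_big sumrB sumr_const card_ord; congr (_ - _).
by apply: eq_bigr => j _; apply: eq_bigr => i _; rewrite mulnA.
Qed.
End Conjugates.

(** * Orders of the entries and the final estimates *)

Lemma dvdn_mul_biggcd (d M w : nat) (a : 'I_w -> nat) :
  (forall i, d %| M * a i)%N -> (d %| M * \big[gcdn/d]_i a i)%N.
Proof.
move=> da; elim/big_rec: _ => [|i y _ IH]; first exact: dvdn_mull.
by rewrite muln_gcdr dvdn_gcd da.
Qed.

Lemma dvdn_fact_mul (C a d : nat) :
  (0 < d)%N -> (d <= C * gcdn a d)%N -> (d %| C`! * a)%N.
Proof.
move=> d0 dC; have g0 : (0 < gcdn a d)%N by rewrite gcdn_gt0 d0 orbT.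
rewrite -{1}(divnK (dvdn_gcdr a d)); apply: dvdn_mul (dvdn_gcdl a d).
by apply: dvdn_fact; rewrite divn_gt0 // dvdn_leq ?dvdn_gcdr //= leq_divLR ?dvdn_gcdr.
Qed.

(** Every order at most [C] divides [C!]. If at most one order exceeded [C], the vanishing sum would
    make [C!] annihilate the remaining entry as well; as the entries generate [Z/d], then [d] would
    divide [C!]. *)
Lemma two_large_orders (C d w : nat) (a : 'I_w.+2 -> nat) : (C`! < d)%N ->
  Aprime d a ->
  exists i0 i1, [/\ i0 != i1, (C * gcdn (a i0) d < d)%N & (C * gcdn (a i1) d < d)%N].
Proof.
move=> Cd /andP[/andP[_ /eqP sa] /eqP ga].
have d0 : (0 < d)%N by apply: leq_ltn_trans Cd.
have absurd : ~ (forall i, d %| C`! * a i)%N.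
  move=> /dvdn_mul_biggcd; rewrite ga muln1 => /(dvdn_leq (fact_gt0 C)).
  by rewrite leqNgt Cd.
have [i0 i0C|none] := pickP (fun i => C * gcdn (a i) d < d)%N; last first.
  by case: absurd => i; apply: dvdn_fact_mul => //; rewrite leqNgt none.
have [i1 /andP[i01 i1C]|none] :=
  pickP (fun i => (i0 != i) && (C * gcdn (a i) d < d)%N).
  by exists i0, i1.
have di i : i != i0 -> (d %| C`! * a i)%N.
  move=> ii0; apply: dvdn_fact_mul => //.
  by have /negbT := none i; rewrite eq_sym ii0 /= -leqNgt.
case: absurd => i; have [->|/di //] := eqVneq i i0.
have : (d %| C`! * \sum_i a i)%N by rewrite dvdn_mull // /dvdn sa.
rewrite (bigD1 i0) //= mulnDr dvdn_addl // big_distrr /=.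
by apply: dvdn_sum => j; apply: di.
Qed.

Lemma gauss_part (R : realType) (eps : R) (n : nat) : 0 < eps ->
    exists C : R,
      forall (p : nat) (P : algC -> Prop) (F : finFieldType) (f d a : nat)
        (zeta : algC) (t : F -> algC),
      prime p -> is_prime_over p P -> #|F| = (p ^ f)%N -> teich P t ->
      p.-primitive_root zeta ->
      C < d%:R -> (p ^ f = 1 %[mod d])%N ->
      (a < d)%N -> coprime a d ->
      deg_le_over (inQzeta zeta) n (gauss p f zeta t d a) ->
      `| ratr (ordP P p (gauss p f zeta t d a) / f%:R) - 2^-1 | < eps.
Proof.
move=> eps0; pose N := Num.bound eps^-1.
have Neps : eps^-1 < N%:R by apply: archi_boundP; rewrite invr_ge0 ltW.
have N0 : (0 < N)%N by rewrite -(ltr0n R); apply: lt_trans Neps; rewrite invr_gt0.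
have [C HC] := unit_equidistribution n N0.
(* The maximum with 1 gives [1 < d], as ['Z_d] is the ring of integers modulo [d] only then. *)
exists (maxn C 1)%:R => p P F f d a zeta t pp PP Fq tP zP.
rewrite ltr_nat gtn_max => /andP[Cd d1] pfd _ ad deg.
have [H [iH avg]] := gauss_average pp PP Fq tP zP pfd d1 ad deg.
have := HC d H a d1 iH; rewrite (eqP ad) muln1 => /(_ Cd) eqd.
have hq : 0 < #|H|%:R :> rat by rewrite ltr0n cardG_gt0.
have fq : 0 < f%:R :> rat by rewrite ltr0n (f_gt0 Fq).
have key : `|ordP P p (gauss p f zeta t d a) / f%:R - 2^-1| <= N%:R^-1.
  rewrite -(ler_pM2r hq) -{1}(gtr0_norm hq) -normrM mulrBl mulrAC avg.
  by rewrite [f%:R * _]mulrC mulfK ?gt_eqF.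
apply: (@le_lt_trans _ _ (ratr N%:R^-1)); last first.
  by rewrite fmorphV /= ratr_nat invf_plt ?posrE ?ltr0n.
have -> : 2^-1 = ratr 2^-1 :> R by rewrite fmorphV /= ratr_nat.
by rewrite -rmorphB -ratr_norm ler_rat.
Qed.

Lemma jacobi_part (R : realType) (n : nat) :
    exists (C eps : R), 0 < eps /\
      forall (p : nat) (P : algC -> Prop) (F : finFieldType) (f d w : nat)
        (a : 'I_w.+2 -> nat) (t : F -> algC),
      prime p -> is_prime_over p P -> #|F| = (p ^ f)%N -> teich P t ->
      C < d%:R -> (p ^ f = 1 %[mod d])%N -> (0 < w)%N -> Aprime d a ->
      deg_le_over (fun y => y \in Crat) n (jacobi t d a) ->
      eps < ratr (ordP P p (jacobi t d a) / f%:R).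
Proof.
(* Accuracy 1/8 gives any entry of order above [C8] a mean of at least 3/8, comfortably above the
   [1 / K] required of a third entry. *)
have [C8 HC8] := unit_equidistribution n (isT : (0 < 8)%N).
pose K := C8.+3; have K0 : (0 < 4 * K)%N by [].
have [C HC] := unit_equidistribution n K0.
(* Two entries of large order contribute [1 - 2 * r] and a third at least [1 / K = 4 * r], so
   [2 * r] remains after subtracting 1. *)
pose r : rat := (4 * K)%:R^-1.
have r0 : 0 < r by rewrite invr_gt0 ltr0n.
exists (maxn C`! 1)%:R, (ratr r); split; first by rewrite ltr0q.
move=> p P F f d w a t pp PP Fq tP; rewrite ltr_nat gtn_max => /andP[Cd d1] pfd w0 aA deg.
(* The Jacobi sum contains no additive character; any choice of [zeta] serves to factor it into
   Gauss sums. *)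
have [zeta zP] := C_prim_root_exists (prime_gt0 pp).
have [H [iH avg]] := jacobi_average pp PP Fq tP zP pfd d1 aA deg.
have hq : 0 < #|H|%:R :> rat by rewrite ltr0n cardG_gt0.
have fq : 0 < f%:R :> rat by rewrite ltr0n (f_gt0 Fq).
have dq : 0 < d%:R :> rat by rewrite ltr0n ltnW.
pose s i : rat := \sum_(h in H) ((unat h * a i) %% d)%N%:R / d%:R.
have s0 i : 0 <= s i by apply: sumr_ge0 => h _; rewrite divr_ge0.
have [i0 [i1 [i01 big0 big1]]] := two_large_orders Cd aA.
have lo (i : 'I_w.+2) : (C * gcdn (a i) d < d)%N -> (2^-1 - r) * #|H|%:R <= s i.
  by move=> /(HC d H (a i) d1 iH); rewrite -/(s i) -/r ler_norml => /andP[+ _]; lra.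
have Kq : 3 <= K%:R :> rat by rewrite ler_nat.
have rK : 4 * r = K%:R^-1 by rewrite /r natrM invfM mulrA divff ?mul1r.
have lo_any i : 4 * r * #|H|%:R <= s i.
  have [C8d|dC8] := ltnP (C8 * gcdn (a i) d)%N d.
    have := HC8 d H (a i) d1 iH C8d; rewrite -/(s i) ler_norml => /andP[+ _].
    have : 4 * r <= 3^-1 by rewrite rK lef_pV2 // posrE; lra.
    by nra.
  (* For an entry of order at most [C8], each residue is a nonzero multiple of [gcdn (a i) d], so
     its fractional part is at least [1 / C8], hence at least [1 / K]. *)
  rewrite mulr_natr -sumr_const; apply: ler_sum => u _.
  rewrite rK ler_pdivlMr // ler_pdivrMl ?(lt_le_trans _ Kq) // -natrM ler_nat.
  apply: leq_trans dC8 _; apply: leq_mul; first by rewrite /K ltnW // ltnW.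
  have /andP[ai0 aid] : (0 < a i < d)%N by case/andP: aA => /andP[/forallP].
  apply: dvdn_leq; last first.
    by rewrite /dvdn modn_dvdm ?dvdn_gcdr // -/(dvdn _ _) dvdn_mull ?dvdn_gcdl.
  by rewrite lt0n -/(dvdn d _) coprime_not_dvd ?coprime_unat // gtnNdvd.
(* The third index exists because [w >= 1] gives at least three entries. *)
have [i2 i20 i21] : exists2 i2, i2 != i0 & i2 != i1.
  have : (0 < #|~: [set i0; i1]|)%N.
    by rewrite cardsCs setCK card_ord cards2 i01 subn_gt0 ltnS.
  by move=> /card_gt0P[i2]; rewrite !inE negb_or => /andP[]; exists i2.
have sum_lo : (1 + 2 * r) * #|H|%:R <= \sum_i s i.
  rewrite (bigD1 i0) //= (bigD1 i1) ?(eq_sym i1) //= (bigD1 i2) ?i20 //=.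
  set rest := \sum_(i | _) _; have rest0 : 0 <= rest by apply: sumr_ge0.
  have := lo i0 big0; have := lo i1 big1; have := lo_any i2; lra.
have key : r < ordP P p (jacobi t d a) / f%:R.
  rewrite ltr_pdivlMr // -(ltr_pM2r hq) avg sumrB exchange_big /= sumr_const.
  rewrite [r * _]mulrC -mulrA ltr_pM2l // -/(s _).
  have : r * #|H|%:R < 2 * r * #|H|%:R by rewrite ltr_pM2r //; lra.
  by have := sum_lo; rewrite /s; lra.
by rewrite ltr_rat.
Qed.

Unset Implicit Arguments.

Theorem theorem2p4 (R : realType) :
  (forall (eps : R) (n : nat), 0 < eps -> (0 < n)%N ->
    exists C : R,
      forall (p : nat) (P : algC -> Prop) (F : finFieldType) (f d a : nat)
        (zeta : algC) (t : F -> algC),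
      prime p -> is_prime_over p P -> #|F| = (p ^ f)%N -> teich P t ->
      p.-primitive_root zeta ->
      C < d%:R -> (p ^ f = 1 %[mod d])%N ->
      (a < d)%N -> coprime a d ->
      deg_le_over (inQzeta zeta) n (gauss p f zeta t d a) ->
      `| ratr (ordP P p (gauss p f zeta t d a) / f%:R) - 2^-1 | < eps)
  /\
  (forall n : nat, (0 < n)%N ->
    exists (C eps : R), 0 < eps /\
      forall (p : nat) (P : algC -> Prop) (F : finFieldType) (f d w : nat)
        (a : 'I_w.+2 -> nat) (t : F -> algC),
      prime p -> is_prime_over p P -> #|F| = (p ^ f)%N -> teich P t ->
      C < d%:R -> (p ^ f = 1 %[mod d])%N -> (0 < w)%N -> Aprime d a ->
      deg_le_over (fun y => y \in Crat) n (jacobi t d a) ->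
      eps < ratr (ordP P p (jacobi t d a) / f%:R)).
Proof.
by split=> [eps n eps0 _|n _]; [apply: gauss_part|apply: jacobi_part].
Qed.
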